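(* Let $K$ be any field and $T\in K^{m_1}\otimes K^{m_2}\otimes K^{m_3}$ a nonzero tight tensor. Then for every $\xi\in\Xi$ and $\theta\in\Theta$, \[ G_\xi(T)=\min_{\theta'\in\Theta(\xi)}\zeta_{\theta'}(T)^{1/\langle\theta',\xi\rangle},\qquad \zeta_\theta(T)=\max_{\xi'\in\Xi}G_{\xi'}(T)^{\langle\theta,\xi'\rangle}. \]
   Context: Support $\mathrm{supp}(T)$: triples $(j_1,j_2,j_3)$ with nonzero coefficient in the standard basis. $T$ is tight if there exist injective maps $u_i:[m_i]\to\mathbb{Z}$ such that $u_1(j_1)+u_2(j_2)+u_3(j_3)$ is constant over $\mathrm{supp}(T)$. $W(T)$: set of triples of marginals $(p_1,p_2,p_3)$ of probability distributions on $\mathrm{supp}(T)$. Support functional: $\zeta_\theta(T)=\max_{p\in W(T)}2^{\sum_i\theta_iH(p_i)}$ ($H$ Shannon entropy base 2). $\Theta=\{\theta\in\mathbb{R}^3_{\ge0}:\sum\theta_i=1\}$, $\Xi=\{\xi\in\mathbb{R}^3_{\ge0}:\max\xi_i=1\}$, $\Theta(\xi)=\{\theta\in\Theta:\theta_i=0\text{ whenever }\xi_i=0\}$. An $i$-slice: tensor whose $i$-th flattening has matrix rank one; slice decomposition of size $(r_1,r_2,r_3)$: sum of $r_i$ $i$-slices. $S_\xi(T)=\min\sum_ir_i^{1/\xi_i}$ ($\xi_i=0$ forces $r_i=0$, term omitted); $G_\xi(T)=\limsup_nS_\xi(T^{\otimes n})^{1/n}$ with Kronecker powers. *)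

(* Defs.v *)
From HB Require Import structures.
From mathcomp Require Import all_boot all_order all_algebra.
From mathcomp Require Import all_classical all_reals all_analysis.

Set Implicit Arguments.
Unset Strict Implicit.
Unset Printing Implicit Defensive.

Import Order.TTheory GRing.Theory Num.Theory.
Import numFieldNormedType.Exports.

Local Open Scope classical_set_scope.
Local Open Scope ring_scope.

(* Factors, slice types and parameters are numbered by 'I_3 = {0, 1, 2}. *)

Definition is_min (R : realType) (E : set R) (v : R) : Prop :=
  E v /\ lbound E v.

Definition is_max (R : realType) (E : set R) (v : R) : Prop :=
  E v /\ ubound E v.

(* An element of K^A (x) K^B (x) K^C, given by its coordinates in the
   standard basis. *)
Definition tensor (K : fieldType) (A B C : finType) := {ffun A * B * C -> K}.

Definition supp (K : fieldType) (A B C : finType) (T : tensor K A B C) :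
    set (A * B * C) :=
  [set j | T j != 0].

Definition tight (K : fieldType) (A B C : finType) (T : tensor K A B C) : Prop :=
  exists (u1 : A -> int) (u2 : B -> int) (u3 : C -> int) (c : int),
    [/\ injective u1, injective u2, injective u3 &
      forall j, supp T j -> u1 j.1.1 + u2 j.1.2 + u3 j.2 = c].

(* The basis of (K^A)^{(x) n} is indexed by A^n. *)
Definition kronecker_pow (K : fieldType) (A B C : finType)
    (T : tensor K A B C) (n : nat) :
    tensor K {ffun 'I_n -> A} {ffun 'I_n -> B} {ffun 'I_n -> C} :=
  [ffun j : {ffun 'I_n -> A} * {ffun 'I_n -> B} * {ffun 'I_n -> C} =>
    \prod_(k < n) T (j.1.1 k, j.1.2 k, j.2 k)].

Definition distribution_on (R : realType) (X : finType) (E : set X)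
    (P : X -> R) : Prop :=
  [/\ forall x, 0 <= P x, \sum_x P x = 1 & forall x, ~ E x -> P x = 0].

Definition marginals (R : realType) (A B C : finType) (P : A * B * C -> R) :
    (A -> R) * (B -> R) * (C -> R) :=
  (fun a => \sum_b \sum_c P (a, b, c),
   fun b => \sum_a \sum_c P (a, b, c),
   fun c => \sum_a \sum_b P (a, b, c)).

Definition marginal_triples (R : realType) (K : fieldType) (A B C : finType)
    (T : tensor K A B C) : set ((A -> R) * (B -> R) * (C -> R)) :=
  [set marginals P | P in distribution_on (supp T)].

(* Base 2; the convention 0 log 0 = 0 is automatic. *)
Definition shannon_entropy (R : realType) (X : finType) (p : X -> R) : R :=
  - \sum_x p x * (ln (p x) / ln 2).

(* The supremum is a maximum when T is nonzero: the distributions on supp T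
   then form a nonempty compact set, on which the entropies are continuous. *)
Definition support_functional (R : realType) (K : fieldType) (A B C : finType)
    (theta : 'I_3 -> R) (T : tensor K A B C) : R :=
  sup [set 2 `^ (\sum_i theta i *
         tnth [tuple shannon_entropy p.1.1; shannon_entropy p.1.2;
                     shannon_entropy p.2] i)
      | p in @marginal_triples R K A B C T].

Definition Theta (R : realType) : set ('I_3 -> R) :=
  [set theta | (forall i, 0 <= theta i) /\ \sum_i theta i = 1].

Definition Xi (R : realType) : set ('I_3 -> R) :=
  [set xi | (forall i, 0 <= xi i) /\ \big[Num.max/0]_i xi i = 1].

Definition Theta_of (R : realType) (xi : 'I_3 -> R) : set ('I_3 -> R) :=
  [set theta | Theta theta /\ forall i, xi i = 0 -> theta i = 0].

Definition pairing (R : realType) (theta xi : 'I_3 -> R) : R :=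
  \sum_i theta i * xi i.

Definition flattening1 (K : fieldType) (A B C : finType) (T : tensor K A B C) :
    'M[K]_(#|A|, #|{: B * C}|) :=
  \matrix_(s, t) T (enum_val s, (enum_val t).1, (enum_val t).2).

Definition flattening2 (K : fieldType) (A B C : finType) (T : tensor K A B C) :
    'M[K]_(#|B|, #|{: A * C}|) :=
  \matrix_(s, t) T ((enum_val t).1, enum_val s, (enum_val t).2).

Definition flattening3 (K : fieldType) (A B C : finType) (T : tensor K A B C) :
    'M[K]_(#|C|, #|{: A * B}|) :=
  \matrix_(s, t) T ((enum_val t).1, (enum_val t).2, enum_val s).

Definition slice (K : fieldType) (A B C : finType) (i : 'I_3)
    (T : tensor K A B C) : Prop :=
  tnth [tuple \rank (flattening1 T); \rank (flattening2 T);
              \rank (flattening3 T)] i = 1%N.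

Definition has_slice_decomposition (K : fieldType) (A B C : finType)
    (r : 'I_3 -> nat) (T : tensor K A B C) : Prop :=
  exists S : forall i : 'I_3, 'I_(r i) -> tensor K A B C,
    (forall i s, slice i (S i s)) /\ T = \sum_i \sum_(s < r i) S i s.

(* The infimum is a minimum for xi in Xi: the set is nonempty and, each
   exponent being positive, has finitely many elements below any bound.
   Terms with xi i = 0 must be left out explicitly, as 0 `^ 0^-1 = 1. *)
Definition slice_size (R : realType) (K : fieldType) (A B C : finType)
    (xi : 'I_3 -> R) (T : tensor K A B C) : R :=
  inf [set \sum_(i | xi i != 0) (r i)%:R `^ (xi i)^-1
      | r in [set r : 'I_3 -> nat | has_slice_decomposition r T /\
                                    forall i, xi i = 0 -> r i = 0%N]].

(* The term n = 0 is irrelevant. For xi in Xi the sequence is bounded by the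
   dimension of a factor i with xi i = 1, so that the real-valued limsup is
   the usual one. *)
Definition asymptotic_slice_size (R : realType) (K : fieldType)
    (A B C : finType) (xi : 'I_3 -> R) (T : tensor K A B C) : R :=
  limn_sup (fun n : nat => slice_size xi (kronecker_pow T n) `^ n%:R^-1).

(* Main.v *)
Require Import Defs.
From HB Require Import structures.
From mathcomp Require Import all_boot all_order all_algebra.
From mathcomp Require Import all_classical all_reals all_analysis.
From mathcomp Require Import ring lra zify.

Set Implicit Arguments.
Unset Strict Implicit.
Unset Printing Implicit Defensive.

Import Order.TTheory GRing.Theory Num.Theory.
Import numFieldNormedType.Exports.

Local Open Scope classical_set_scope.
Local Open Scope ring_scope.

(** The exponent of [asymptotic_slice_size xi T] is the max-min
    [g = max_P min_(xi_i <> 0) H(P_i) / xi_i], where [P] ranges over the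
    distributions on the support.

    Upper bound: the word [j] of the support of [T^n] has an empirical
    distribution [P], and is put into an [i]-slice for an [i] with
    [H(P_i) <= xi_i g]; by the method of types this needs at most
    [exp (n (xi_i g + o(1)))] slices of type [i].

    Lower bound: powers of [T] are tight, so their supports are antichains for
    the orders given by the tightness maps, and then (Tao, Sawin) a slice
    decomposition of size [r] yields a vertex cover of the support of size [r].
    One of the three parts of the cover has mass at least 1/3 under the power of
    the marginal [P_i], hence at least [exp (n (H(P_i) - o(1)))] elements.

    The first duality is then a minimax theorem for three concave functions, and
    the second one follows by choosing [xi] proportional to the marginal
    entropies of a distribution attaining the support functional. *)

(** * Slice decompositions and vertex covers *)

Definition o0 : 'I_3 := @Ordinal 3 0 isT.
Definition o1 : 'I_3 := @Ordinal 3 1 isT.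
Definition o2 : 'I_3 := @Ordinal 3 2 isT.

Lemma ord3_ind (P : 'I_3 -> Prop) : P o0 -> P o1 -> P o2 -> forall i, P i.
Proof.
move=> P0 P1 P2 [[|[|[|//]]] lt3].
- by rewrite (_ : Ordinal lt3 = o0)//; exact: val_inj.
- by rewrite (_ : Ordinal lt3 = o1)//; exact: val_inj.
- by rewrite (_ : Ordinal lt3 = o2)//; exact: val_inj.
Qed.

Lemma big_ord3 (V : nmodType) (F : 'I_3 -> V) :
  \sum_i F i = F o0 + F o1 + F o2.
Proof.
rewrite !big_ord_recl big_ord0 addr0 addrA.
by congr (F _ + F _ + F _); exact: val_inj.
Qed.

Lemma rank1_factor (K : fieldType) m n (M : 'M[K]_(m, n)) :
  \rank M = 1%N -> exists f g, forall i j, M i j = f i * g j.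
Proof.
move=> rk; have := mulmx_base M.
move: (col_base M) (row_base M); rewrite rk => F G FG.
exists (F ^~ ord0), (G ord0) => i j.
by rewrite -{1}FG mxE big_ord1.
Qed.

Lemma rank_outer (K : fieldType) m n (M : 'M[K]_(m, n)) f g :
  (forall i j, M i j = f i * g j) -> (\rank M <= 1)%N.
Proof.
move=> ME; rewrite (_ : M = (\col_i f i) *m (\row_j g j)) ?mulmx_max_rank//.
by apply/matrixP => i j; rewrite mxE big_ord1 !mxE ME.
Qed.

Section slices.
Variables (K : fieldType) (A B C : finType).
Implicit Types T : tensor K A B C.

Lemma flattening1E T a b c :
  flattening1 T (enum_rank a) (enum_rank (b, c)) = T (a, b, c).
Proof. by rewrite mxE !enum_rankK. Qed.

Lemma flattening2E T a b c :
  flattening2 T (enum_rank b) (enum_rank (a, c)) = T (a, b, c).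
Proof. by rewrite mxE !enum_rankK. Qed.

Lemma flattening3E T a b c :
  flattening3 T (enum_rank c) (enum_rank (a, b)) = T (a, b, c).
Proof. by rewrite mxE !enum_rankK. Qed.

Lemma slice1_factor T : slice o0 T ->
  exists f g, forall a b c, T (a, b, c) = f a * g b c.
Proof.
move=> /rank1_factor[f [g fg]].
exists (fun a => f (enum_rank a)), (fun b c => g (enum_rank (b, c))) => a b c.
by rewrite -flattening1E fg.
Qed.

Lemma slice2_factor T : slice o1 T ->
  exists f g, forall a b c, T (a, b, c) = f b * g a c.
Proof.
move=> /rank1_factor[f [g fg]].
exists (fun a => f (enum_rank a)), (fun b c => g (enum_rank (b, c))) => a b c.
by rewrite -flattening2E fg.
Qed.

Lemma slice3_factor T : slice o2 T ->
  exists f g, forall a b c, T (a, b, c) = f c * g a b.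
Proof.
move=> /rank1_factor[f [g fg]].
exists (fun a => f (enum_rank a)), (fun b c => g (enum_rank (b, c))) => a b c.
by rewrite -flattening3E fg.
Qed.

Lemma factor_slice1 T f g : T != 0 ->
  (forall a b c, T (a, b, c) = f a * g b c) -> slice o0 T.
Proof.
move=> T0 fg; rewrite /slice /=; apply/eqP; rewrite eqn_leq.
rewrite (@rank_outer _ _ _ _ (fun s => f (enum_val s))
  (fun t => g (enum_val t).1 (enum_val t).2)) /=; last first.
  by move=> i j; rewrite mxE fg.
rewrite lt0n mxrank_eq0; apply: contra T0 => /eqP F0.
apply/eqP/ffunP => -[[a b] c]; rewrite -flattening1E F0 !ffunE.
by rewrite mxE.
Qed.

Lemma factor_slice2 T f g : T != 0 ->
  (forall a b c, T (a, b, c) = f b * g a c) -> slice o1 T.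
Proof.
move=> T0 fg; rewrite /slice /=; apply/eqP; rewrite eqn_leq.
rewrite (@rank_outer _ _ _ _ (fun s => f (enum_val s))
  (fun t => g (enum_val t).1 (enum_val t).2)) /=; last first.
  by move=> i j; rewrite mxE fg.
rewrite lt0n mxrank_eq0; apply: contra T0 => /eqP F0.
apply/eqP/ffunP => -[[a b] c]; rewrite -flattening2E F0 !ffunE.
by rewrite mxE.
Qed.

Lemma factor_slice3 T f g : T != 0 ->
  (forall a b c, T (a, b, c) = f c * g a b) -> slice o2 T.
Proof.
move=> T0 fg; rewrite /slice /=; apply/eqP; rewrite eqn_leq.
rewrite (@rank_outer _ _ _ _ (fun s => f (enum_val s))
  (fun t => g (enum_val t).1 (enum_val t).2)) /=; last first.
  by move=> i j; rewrite mxE fg.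
rewrite lt0n mxrank_eq0; apply: contra T0 => /eqP F0.
apply/eqP/ffunP => -[[a b] c]; rewrite -flattening3E F0 !ffunE.
by rewrite mxE.
Qed.

(** A slice has rank exactly one, so zero terms must be discarded; this is why only a bound on each
    [r i] is obtained. *)
Lemma seq_slice_decomposition (W : 'I_3 -> seq (tensor K A B C)) T :
  (forall i t, t \in W i -> t != 0 -> slice i t) ->
  T = \sum_i \sum_(t <- W i) t ->
  exists2 r : 'I_3 -> nat,
    has_slice_decomposition r T & forall i, (r i <= size (W i))%N.
Proof.
move=> Wslice TE; pose W' i := [seq t <- W i | t != 0].
exists (fun i => size (W' i)); last by move=> i; rewrite size_filter count_size.
exists (fun i (s : 'I_(size (W' i))) => nth 0 (W' i) s); split.
  move=> i s; have : nth 0 (W' i) s \in W' i by rewrite mem_nth.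
  by rewrite mem_filter => /andP[t0 tW]; exact: Wslice tW t0.
rewrite TE; apply: eq_bigr => i _.
transitivity (\sum_(t <- W' i) t); last by rewrite (big_nth 0) big_mkord.
rewrite big_filter [RHS]big_mkcond /=; apply: eq_bigr => t _.
by case: eqP => //= ->.
Qed.

Definition vertex_cover (V1 : {set A}) (V2 : {set B}) (V3 : {set C}) T : Prop :=
  forall j, supp T j -> [|| j.1.1 \in V1, j.1.2 \in V2 | j.2 \in V3].

(** Each entry of the support is assigned to the first of [V1], [V2], [V3] that contains its
    coordinate, so that no entry is counted twice. *)
Lemma slice_decomposition_of_cover (V1 : {set A}) (V2 : {set B}) (V3 : {set C}) T :
  vertex_cover V1 V2 V3 T ->
  exists2 r, has_slice_decomposition r T &
    [/\ (r o0 <= #|V1|)%N, (r o1 <= #|V2|)%N & (r o2 <= #|V3|)%N].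
Proof.
move=> cov.
pose S1 a : tensor K A B C := [ffun j => if j.1.1 == a then T j else 0].
pose S2 b : tensor K A B C :=
  [ffun j => if (j.1.2 == b) && (j.1.1 \notin V1) then T j else 0].
pose S3 c : tensor K A B C :=
  [ffun j => if [&& j.2 == c, j.1.1 \notin V1 & j.1.2 \notin V2] then T j else 0].
pose W i := tnth [tuple [seq S1 a | a in V1]; [seq S2 b | b in V2];
                  [seq S3 c | c in V3]] i.
have [||r Tr rW] := @seq_slice_decomposition W T.
- apply: ord3_ind => t; rewrite /W /= => /fintype.imageP[x xV ->] t0.
  + apply: (@factor_slice1 _ (fun a => (a == x)%:R) (fun b c => T (x, b, c))) => //.
    by move=> a b c; rewrite ffunE /=; case: eqP => [->|]; rewrite ?mul1r ?mul0r.
  + apply: (@factor_slice2 _ (fun a => (a == x)%:R)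
      (fun a c => if a \notin V1 then T (a, x, c) else 0)) => //.
    move=> a b c; rewrite ffunE /=.
    by case: (b =P x) => [->|]; rewrite ?mul1r ?mul0r.
  + apply: (@factor_slice3 _ (fun a => (a == x)%:R)
      (fun a b => if (a \notin V1) && (b \notin V2) then T (a, b, x) else 0)) => //.
    move=> a b c; rewrite ffunE /=.
    by case: (c =P x) => [->|]; rewrite ?mul1r ?mul0r.
- rewrite big_ord3 /W /= !big_image /=.
  apply/ffunP => j; rewrite !ffunE !sum_ffunE.
  have pick1 (I : finType) (V : {set I}) (x : I) (F : tensor K A B C) :
      \sum_(y in V) (if x == y then F j else 0) = if x \in V then F j else 0.
    rewrite -big_mkcondr /=; case: ifPn => xV.
      by rewrite (big_pred1 x) // => y; rewrite /= eq_sym andbC; case: eqP => // ->.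
    by rewrite big1 // => y /andP[yV /eqP xy]; rewrite xy yV in xV.
  under eq_bigr do rewrite ffunE.
  under [X in _ + X + _]eq_bigr do rewrite ffunE.
  under [X in _ + _ + X]eq_bigr do rewrite ffunE.
  rewrite pick1; have := cov j; rewrite /supp /=.
  have [j1|j1] := boolP (j.1.1 \in V1); rewrite /= ?andbT ?andbF => covj.
    rewrite !big1 ?addr0 //.
    + by move=> c _; rewrite andbF.
    + by move=> b _; rewrite andbF.
  under eq_bigr do rewrite andbT.
  rewrite pick1 add0r.
  have [j2|j2] := boolP (j.1.2 \in V2); rewrite /= ?andbT ?andbF.
    by rewrite big1 ?addr0 // => c _; rewrite andbF.
  under eq_bigr do rewrite andbT.
  rewrite pick1 add0r; case: ifPn => // j3.
  have [//|Tj] := eqVneq (T j) 0.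
  by move/covj: Tj; rewrite (negPf j2) (negPf j3).
- exists r => //.
  by have := (rW o0, rW o1, rW o2); rewrite /W /= !size_image => -[[]].
Qed.

End slices.

(** * Leading positions of vectors orthogonal to given functionals *)

Section leading.
Variables (K : fieldType) (A : finType) (u : A -> int).
Hypothesis u_inj : injective u.

Definition leading_at (a : A) (v : A -> K) : Prop :=
  v a != 0 /\ forall a', u a' < u a -> v a' = 0.

(* Gaussian elimination: adding one more functional costs at most one leading
   position, namely the largest one at which the functional does not vanish. *)
Lemma orthogonal_leading r (phi : 'I_r -> A -> K) :
  exists2 V : {set A}, (#|V| <= r)%N &
    forall a, a \notin V -> exists2 v, leading_at a v &
      forall s, \sum_a' v a' * phi s a' = 0.
Proof.
elim: r phi => [|r IH] phi.
  exists (finset.set0) => [|a _]; first by rewrite cards0.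
  exists (fun a' => (a' == a)%:R) => [|[]//].
  split=> [|a' lt_a]; first by rewrite eqxx oner_neq0.
  by case: eqP => // aa; rewrite aa ltxx in lt_a.
have [V cV hV] := IH (fun s => phi (lift ord0 s)).
pose orth v := forall s, \sum_a' v a' * phi (lift ord0 s) a' = 0.
have orthS v : orth v -> \sum_a' v a' * phi ord0 a' = 0 ->
    forall s, \sum_a' v a' * phi s a' = 0.
  by move=> ov v0 s; case: (unliftP ord0 s) => [s' ->|->].
(* A bad position has a leading vector killed by the other functionals but not by [phi ord0]. Only
   the highest one is added to [V]. *)
pose bad a := `[< a \notin V /\ exists v, [/\ leading_at a v, orth v &
  \sum_a' v a' * phi ord0 a' != 0] >].
have [a1 bad1|nobad] := pickP bad; last first.
  exists V => [|a aV]; first exact: leqW.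
  have [v lv ov] := hV a aV; exists v => //; apply: orthS => //.
  apply/eqP; apply: contraFT (nobad a) => v0.
  by apply/asboolP; split => //; exists v.
case: (Order.TotalTheory.arg_maxP u bad1) => a0 /asboolP[a0V [v0 [[l0 l0'] ov0 n0]]] max0.
exists (a0 |: V)%SET => [|a]; first by rewrite cardsU1 a0V.
rewrite !inE negb_or => /andP[aa0 aV].
have [v lv ov] := hV a aV.
have [vz|vnz] := eqVneq (\sum_a' v a' * phi ord0 a') 0.
  by exists v => //; exact: orthS.
have lt_a : u a < u a0.
  rewrite lt_neqAle (inj_eq u_inj) aa0 /=; apply: max0.
  by apply/asboolP; split => //; exists v.
(* With this [c], [phi ord0] kills [v - c v0]. The leading position is still [a]: it lies below
   [a0], and [v0] vanishes there and further down. *)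
pose c := (\sum_a' v a' * phi ord0 a') / (\sum_a' v0 a' * phi ord0 a').
have lin f : \sum_a' (v a' - c * v0 a') * f a' =
    \sum_a' v a' * f a' - c * \sum_a' v0 a' * f a'.
  rewrite mulr_sumr -sumrB; apply: eq_bigr => a' _.
  by rewrite mulrBl mulrA.
exists (fun a' => v a' - c * v0 a').
  split; first by rewrite (l0' a) // mulr0 subr0; case: lv.
  move=> a' lt_a'; rewrite (lv.2 _ lt_a') (l0' a') ?mulr0 ?subr0 //.
  exact: lt_trans lt_a.
apply: orthS => [s|]; rewrite lin.
  by rewrite ov ov0 mulr0 subr0.
by rewrite /c divfK // subrr.
Qed.

End leading.

(** * From slice decompositions to vertex covers *)

Section cover.
Variables (K : fieldType) (A B C : finType).
Implicit Types T : tensor K A B C.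

Definition contract T (v1 : A -> K) (v2 : B -> K) (v3 : C -> K) : K :=
  \sum_a \sum_b \sum_c T (a, b, c) * (v1 a * v2 b * v3 c).

Lemma contract_sum I (r : seq I) (P : pred I) (F : I -> tensor K A B C) v1 v2 v3 :
  contract (\sum_(i <- r | P i) F i) v1 v2 v3 =
  \sum_(i <- r | P i) contract (F i) v1 v2 v3.
Proof.
rewrite /contract [RHS]exchange_big; apply: eq_bigr => a _ /=.
rewrite [RHS]exchange_big; apply: eq_bigr => b _ /=.
rewrite [RHS]exchange_big; apply: eq_bigr => c _ /=.
by rewrite sum_ffunE mulr_suml.
Qed.

(* A pure tensor of leading vectors picks out a single entry of a tight
   tensor, because the support is an antichain; but it annihilates all slices. *)
Lemma cover_of_slice_decomposition T r : tight T ->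
  has_slice_decomposition r T ->
  exists (V1 : {set A}) (V2 : {set B}) (V3 : {set C}), [/\ (#|V1| <= r o0)%N, (#|V2| <= r o1)%N,
    (#|V3| <= r o2)%N & vertex_cover V1 V2 V3 T].
Proof.
move=> [u1 [u2 [u3 [e [i1 i2 i3 Tu]]]]] [S [Ss TE]].
have /choice[f1 hf1] s := slice1_factor (Ss o0 s).
have /choice[f2 hf2] s := slice2_factor (Ss o1 s).
have /choice[f3 hf3] s := slice3_factor (Ss o2 s).
have [V1 c1 h1] := orthogonal_leading i1 f1.
have [V2 c2 h2] := orthogonal_leading i2 f2.
have [V3 c3 h3] := orthogonal_leading i3 f3.
exists V1, V2, V3; split=> // -[[a b] c] Tabc; apply/negPn/negP => /=.
rewrite !negb_or => /and3P[/h1[v1 [n1 l1] o1'] /h2[v2 [n2 l2] o2'] /h3[v3 [n3 l3] o3']].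
have : contract T v1 v2 v3 = 0.
  rewrite TE contract_sum big1 // => i _; rewrite contract_sum big1 //.
  move: i; apply: ord3_ind => s _; rewrite /contract.
  - have [g Sg] := hf1 s; rewrite exchange_big big1 // => b' _.
    rewrite exchange_big big1 // => c' _; have := o1' s.
    move=> /(congr1 ( *%R (g b' c' * v2 b' * v3 c'))); rewrite mulr0 => E; rewrite -[RHS]E.
    by rewrite mulr_sumr; apply: eq_bigr => a' _; rewrite Sg; ring.
  - have [g Sg] := hf2 s; rewrite big1 // => a' _.
    rewrite exchange_big big1 // => c' _; have := o2' s.
    move=> /(congr1 ( *%R (g a' c' * v1 a' * v3 c'))); rewrite mulr0 => E; rewrite -[RHS]E.
    by rewrite mulr_sumr; apply: eq_bigr => b' _; rewrite Sg; ring.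
  - have [g Sg] := hf3 s; rewrite big1 // => a' _.
    rewrite big1 // => b' _; have := o3' s.
    move=> /(congr1 ( *%R (g a' b' * v1 a' * v2 b'))); rewrite mulr0 => E; rewrite -[RHS]E.
    by rewrite mulr_sumr; apply: eq_bigr => c' _; rewrite Sg; ring.
(* A nonzero term needs [u1 a' >= u1 a] and likewise for the other two factors. Both triples have
   the same sum [e], so all three are equalities, and injectivity identifies the triples. *)
have zero a' b' c' : (a', b', c') != (a, b, c) ->
    T (a', b', c') * (v1 a' * v2 b' * v3 c') = 0.
  move=> ne; have [->|Tn] := eqVneq (T (a', b', c')) 0; first by rewrite mul0r.
  have [/l1->|a_le] := ltP (u1 a') (u1 a); first by rewrite !mul0r mulr0.
  have [/l2->|b_le] := ltP (u2 b') (u2 b); first by rewrite mulr0 mul0r mulr0.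
  have [/l3->|c_le] := ltP (u3 c') (u3 c); first by rewrite !mulr0.
  have /= e1 := Tu _ Tabc; have /= e2 := Tu _ Tn.
  move: ne; have -> : a' = a by apply: i1; lia.
  have -> : b' = b by apply: i2; lia.
  by have -> : c' = c by [apply: i3; lia]; rewrite eqxx.
rewrite /contract (bigD1 a) //= [X in _ + X]big1 ?addr0; last first.
  move=> a' na; rewrite big1 // => b' _; rewrite big1 // => c' _.
  by apply: zero; apply: contra na => /eqP[-> _ _].
rewrite (bigD1 b) //= [X in _ + X]big1 ?addr0; last first.
  move=> b' nb; rewrite big1 // => c' _.
  by apply: zero; apply: contra nb => /eqP[-> _].
rewrite (bigD1 c) //= [X in _ + X]big1 ?addr0; last first.
  by move=> c' nc; apply: zero; apply: contra nc => /eqP[->].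
by apply/eqP; rewrite !mulf_neq0.
Qed.

End cover.

(** * Tightness of Kronecker powers *)

Section tight_pow.

(** The lowest digit is a multiple of [M] smaller than [M] in absolute value, hence zero; dividing
    the rest by [M] allows induction. *)
Lemma base_expansion_eq0 n (d : 'I_n -> int) (M : int) :
  (forall k, `|d k| < M) -> \sum_k d k * M ^+ k = 0 -> forall k, d k = 0.
Proof.
elim: n d => [|n IH] d dM; first by move=> _ [].
rewrite big_ord_recl expr0 mulr1.
under eq_bigr do rewrite lift0 exprSr mulrA.
rewrite -mulr_suml; set s := \sum_i _ => e0.
have d0 : d ord0 = 0.
  have [s0|s0] := eqVneq s 0; first by rewrite s0 mul0r addr0 in e0.
  have := dM ord0; rewrite (_ : d ord0 = - (s * M)); last first.
    by apply/eqP; rewrite -addr_eq0; apply/eqP.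
  rewrite normrN normrM.
  have M0 : 0 < M by apply: le_lt_trans (dM ord0).
  rewrite (gtr0_norm M0) -[X in _ < X]mul1r ltr_pM2r //.
  by move=> s1; exfalso; lia.
have s0 : s = 0.
  move: e0; rewrite d0 add0r => /eqP; rewrite mulf_eq0 => /orP[/eqP//|/eqP M0].
  by have := le_lt_trans (normr_ge0 _) (dM ord0); rewrite M0 ltxx.
have IH' := IH (fun k => d (lift ord0 k)) (fun k => dM _) s0.
by move=> k; case: (unliftP ord0 k) => [k' ->|->] //.
Qed.

Variables (K : fieldType) (A B C : finType).

Lemma supp_kronecker_pow (T : tensor K A B C) n j :
  supp (kronecker_pow T n) j <-> forall k, supp T (j.1.1 k, j.1.2 k, j.2 k).
Proof.
rewrite /supp /= ffunE; split => [/prodf_neq0 h k|h]; first exact: h.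
by apply/prodf_neq0 => k _; exact: h.
Qed.

Lemma tight_kronecker_pow (T : tensor K A B C) n :
  tight T -> tight (kronecker_pow T n).
Proof.
move=> [u1 [u2 [u3 [e [i1 i2 i3 Tu]]]]].
pose bnd (I : finType) (u : I -> int) : int := \sum_a `|u a|.
have bndP (I : finType) (u : I -> int) a a' : `|u a - u a'| <= bnd I u *+ 2.
  have le_b x : `|u x| <= bnd I u.
    by rewrite /bnd (bigD1 x) //= lerDl sumr_ge0.
  by rewrite (le_trans (ler_normB _ _)) // mulr2n lerD.
have inj (I : finType) (u : I -> int) (M : int) : injective u -> bnd I u *+ 2 < M ->
    injective (fun j : {ffun 'I_n -> I} => \sum_k u (j k) * M ^+ k).
  move=> ui uM j j' jj'; apply/ffunP => k; apply: ui; apply/eqP; rewrite -subr_eq0.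
  apply/eqP; move: k; apply: (@base_expansion_eq0 n (fun k => u (j k) - u (j' k)) M).
    by move=> k; apply: le_lt_trans uM; exact: bndP.
  by under eq_bigr do rewrite mulrBl; rewrite sumrB jj' subrr.
(* Words are read in base [M]. It exceeds every difference of two values of the same tightness map,
   whence injectivity; sharing it among the three factors keeps the sum constant. *)
pose M : int := (bnd A u1 + bnd B u2 + bnd C u3) *+ 2 + 1.
have b0 (I : finType) (u : I -> int) : 0 <= bnd I u by exact: sumr_ge0.
have := (b0 _ u1, b0 _ u2, b0 _ u3) => -[[b1 b2] b3].
exists (fun j : {ffun 'I_n -> A} => \sum_k u1 (j k) * M ^+ k), (fun j : {ffun 'I_n -> B} => \sum_k u2 (j k) * M ^+ k),
  (fun j : {ffun 'I_n -> C} => \sum_k u3 (j k) * M ^+ k), (\sum_(k < n) e * M ^+ k); split.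
- by apply: inj => //; rewrite /M; lia.
- by apply: inj => //; rewrite /M; lia.
- by apply: inj => //; rewrite /M; lia.
move=> j /supp_kronecker_pow Tj; rewrite -!big_split /=; apply: eq_bigr => k _.
by rewrite -!mulrDl (Tu _ (Tj k)).
Qed.

End tight_pow.

(** * Minimax and entropy *)

Section minimax.
Variables (R : realType) (E : Type) (mix : R -> E -> E -> E).
Implicit Types (C : set E) (f g : E -> R).

(** Convexity relative to the operation [mix], so that [E] may be any type; [mix_fun] is used
    later. *)
Definition mix_closed C : Prop :=
  forall t p q, 0 <= t <= 1 -> C p -> C q -> C (mix t p q).

Definition concave_on C f : Prop :=
  forall t p q, 0 <= t <= 1 -> C p -> C q ->
    t * f p + (1 - t) * f q <= f (mix t p q).

Lemma concave_onS C C' f : C' `<=` C -> concave_on C f -> concave_on C' f.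
Proof. by move=> sub cf t p q t01 /sub Cp /sub Cq; exact: cf. Qed.

Lemma concave_on_sum (I : finType) C (F : I -> E -> R) (w : I -> R) :
  (forall i, 0 <= w i) -> (forall i, concave_on C (F i)) ->
  concave_on C (fun p => \sum_i w i * F i p).
Proof.
move=> w0 cF t p q t01 Cp Cq; rewrite !mulr_sumr -big_split /=.
apply: ler_sum => i _; rewrite mulrCA [(1 - t) * _]mulrCA -mulrDr.
by rewrite ler_wpM2l // cF.
Qed.

(* If [f p, g q > 0] while [f q, g p <= 0], some mixture of [p] and [q] makes
   both positive unless [g q / (- f q) <= (- g p) / f p]; hence a separating
   slope exists. *)
Lemma two_concave C f g : mix_closed C -> concave_on C f -> concave_on C g ->
  (forall p, C p -> f p <= 0 \/ g p <= 0) ->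
  exists a b, [/\ 0 <= a, 0 <= b, 0 < a + b &
    forall p, C p -> a * f p + b * g p <= 0].
Proof.
move=> Cmix cf cg fg.
have [fle|] := pselect (forall p, C p -> f p <= 0).
  by exists 1, 0; split=> [|||p /fle]; rewrite ?addr0 ?mul1r ?mul0r ?addr0.
move=> /existsNP[p0 /not_implyP[Cp0 /negP]]; rewrite -ltNge => fp0.
have gle p : C p -> 0 < f p -> g p <= 0.
  by move=> /fg[|//]; rewrite leNgt => /negbTE ->.
pose D := [set - g p / f p | p in [set p | C p /\ 0 < f p]].
have D0 : lbound D 0.
  by move=> _ [p [Cp fp] <-]; rewrite divr_ge0 ?(ltW fp) // oppr_ge0 gle.
have Dn : D !=set0 by exists (- g p0 / f p0), p0.
have hD : has_inf D by split => //; exists 0.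
have iD0 : 0 <= inf D by exact: lb_le_inf.
exists (inf D), 1; split=> //; first by rewrite ltr_wpDl.
move=> q Cq; rewrite mul1r.
have [fq|fq] := ltP 0 (f q).
  rewrite -lerBrDr sub0r -ler_pdivlMr //.
  by apply: ge_inf; [exists 0|exists q].
have [gq|gq] := leP (g q) 0.
  by have := mulr_ge0_le0 iD0 fq; lra.
rewrite leNgt; apply/negP => pos.
(* If [q] violates the inequality for the slope [inf D], it still does so for some slope in [D]
   close to the infimum. *)
have [p [Cp fp] ltp] : exists2 p, C p /\ 0 < f p & - g p / f p * (- f q) < g q.
  have [->|fq0] := eqVneq (f q) 0; first by exists p0 => //; rewrite oppr0 mulr0.
  have nfq : 0 < - f q by rewrite oppr_gt0 lt_neqAle fq0.
  have : inf D < g q / - f q by rewrite ltr_pdivlMr //; lra.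
  move=> /(inf_lt Dn)[_ [p [Cp fp] <-] lt_p]; exists p => //.
  by rewrite -ltr_pdivlMr.
have {}ltp : g p * f q < g q * f p.
  by move: ltp; rewrite mulrAC ltr_pdivrMr // mulrNN.
have gp := gle p Cp fp.
(* The weight [al / (al + be)] gives [f] and [g] the same average over [p] and [q], namely
   [(g q * f p - g p * f q) / (al + be)], which is positive. *)
pose al := g q - f q; pose be := f p - g p.
have al0 : 0 < al by rewrite /al; lra.
have be0 : 0 < be by rewrite /be; lra.
have s0 : 0 < al + be by exact: addr_gt0.
pose t := al / (al + be).
have t01 : 0 <= t <= 1.
  rewrite /t divr_ge0 ?(ltW al0) ?(ltW s0) //= ler_pdivrMr // mul1r; lra.
have t1 : 1 - t = be / (al + be) by rewrite /t; field; rewrite gt_eqF.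
have posf : 0 < t * f p + (1 - t) * f q.
  rewrite t1 /t mulrAC [be / _ * _]mulrAC -mulrDl divr_gt0 // /al /be; lra.
have posg : 0 < t * g p + (1 - t) * g q.
  rewrite t1 /t mulrAC [be / _ * _]mulrAC -mulrDl divr_gt0 // /al /be; lra.
have := fg _ (Cmix t p q t01 Cp Cq).
have := cf t p q t01 Cp Cq; have := cg t p q t01 Cp Cq.
by move=> h1 h2 [h3|h3]; lra.
Qed.

(** Induction on [s]: where [F i0] is positive, the other functions admit weights with nonpositive
    weighted sum, and [two_concave] combines this sum with [F i0]. *)
Lemma concave_minimax (I : finType) (F : I -> E -> R) (s : seq I) C :
  mix_closed C -> (forall i, concave_on C (F i)) -> s != [::] ->
  (forall p, C p -> exists2 i, i \in s & F i p <= 0) ->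
  exists w : I -> R, [/\ forall i, 0 <= w i, forall i, i \notin s -> w i = 0,
    0 < \sum_i w i & forall p, C p -> \sum_i w i * F i p <= 0].
Proof.
elim: s C => // i0 s IH C Cmix cF _ hs.
pose dl i : R := (i == i0)%:R.
have dlE (G : I -> R) : \sum_i dl i * G i = G i0.
  rewrite (bigD1 i0) //= /dl eqxx mul1r big1 ?addr0 // => i /negbTE ->.
  by rewrite mul0r.
have dl1 : \sum_i dl i = 1.
  by rewrite -[RHS](dlE (fun=> 1)); apply: eq_bigr => i _; rewrite mulr1.
case: s IH hs => [|i1 s] IH hs.
  exists dl; split.
  - by move=> i; rewrite /dl ler0n.
  - by move=> i; rewrite inE /dl => /negbTE ->.
  - by rewrite dl1.
  - by move=> p Cp; rewrite dlE; have [i] := hs p Cp; rewrite inE => /eqP ->.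
pose C' := [set p | C p /\ 0 < F i0 p].
have C'C : C' `<=` C by move=> p [].
have [||//||w [w0 ws wpos wle]] := IH C'.
- move=> t p q t01 [Cp fp] [Cq fq]; split; first exact: Cmix.
  apply: lt_le_trans (cF _ _ _ _ t01 Cp Cq); case/andP: t01 => t0 t1.
  have [->|tn] := eqVneq t 0; first by rewrite mul0r add0r subr0 mul1r.
  have tp : 0 < t by rewrite lt_neqAle eq_sym tn.
  by rewrite ltr_pwDl ?mulr_gt0 // mulr_ge0 ?(ltW fq) // subr_ge0.
- by move=> i; exact: concave_onS (cF i).
- move=> p [Cp fp]; have [i] := hs p Cp.
  rewrite inE => /orP[/eqP ->|ins]; last by exists i.
  by rewrite leNgt fp.
have [|p Cp|a [b [a0 b0 ab able]]] :=
    @two_concave C (F i0) (fun p => \sum_i w i * F i p) Cmix (cF i0).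
- exact: concave_on_sum.
- have [/= Fp|Fp] := ltP 0 (F i0 p); last by left.
  by right; exact: wle.
exists (fun i => a * dl i + b * w i); split.
- by move=> i; rewrite addr_ge0 ?mulr_ge0 // /dl ler0n.
- move=> i; rewrite inE negb_or => /andP[ni0 nis].
  by rewrite ws // /dl (negbTE ni0) !mulr0 addr0.
- rewrite big_split /= -!mulr_sumr dl1 mulr1.
  have [bz|bn] := eqVneq b 0; first by move: ab; rewrite bz mul0r.
  by rewrite ltr_wpDl // mulr_gt0 // lt_neqAle eq_sym bn.
- move=> p /able; rewrite mulr_sumr -(dlE (F ^~ p)) mulr_sumr -big_split /=.
  congr (_ <= _); apply: eq_bigr => i _; ring.
Qed.

End minimax.

(** * Concavity and continuity of the entropy *)

Section entropy.
Variable R : realType.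
Implicit Types (x y z t : R).

(** As [ln] is zero on nonpositive reals, [eta] is zero there and continuous on the whole line, so
    no domain has to be carried along. *)
Definition eta x : R := - (x * ln x).

Lemma eta_le0 x : x <= 0 -> eta x = 0.
Proof. by move=> x0; rewrite /eta ln0 // mulr0 oppr0. Qed.

Lemma eta_ge0 x : x <= 1 -> 0 <= eta x.
Proof.
move=> x1; have [x0|x0] := leP x 0; first by rewrite eta_le0.
by rewrite /eta -mulrN mulr_ge0 ?(ltW x0) // oppr_ge0 ln_le0.
Qed.

(** The right-hand side is the tangent line of [eta] at [z]. Concavity follows by averaging it at
    two points with mean [z]. *)
Lemma eta_tangent x z : 0 <= x -> 0 < z -> eta x <= - (x * ln z) + z - x.
Proof.
move=> x0 z0; have [->|xn] := eqVneq x 0.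
  by rewrite eta_le0 // mul0r oppr0 add0r addr0 ltW.
have {xn}x0 : 0 < x by rewrite lt_neqAle eq_sym xn.
have := @le_ln1Dx R (z / x - 1).
rewrite [1 + _]addrC subrK ltrBrDr addNr divr_gt0 // => /(_ isT).
rewrite ln_div ?posrE // -(ler_pM2l x0) mulrBr mulrBr mulr1 mulrCA mulfV ?gt_eqF //.
by rewrite mulr1 /eta; lra.
Qed.

Lemma eta_concave x y t : 0 <= x -> 0 <= y -> 0 <= t <= 1 ->
  t * eta x + (1 - t) * eta y <= eta (t * x + (1 - t) * y).
Proof.
move=> x0 y0 /andP[t0 t1]; have t1' : 0 <= 1 - t by rewrite subr_ge0.
set z := t * x + _.
have [z0|zn] := eqVneq z 0.
  have [tx ty] : t * x = 0 /\ (1 - t) * y = 0.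
    have := mulr_ge0 t0 x0; have := mulr_ge0 t1' y0; rewrite /z in z0; split; lra.
  by rewrite /eta z0 mul0r !mulrN !mulrA tx ty !mul0r oppr0 addr0.
have z0 : 0 < z by rewrite lt_neqAle eq_sym zn addr_ge0 // mulr_ge0.
have hx := ler_wpM2l t0 (eta_tangent x0 z0).
have hy := ler_wpM2l t1' (eta_tangent y0 z0).
rewrite [eta z]/eta; have zl : z * ln z = t * (x * ln z) + (1 - t) * (y * ln z).
  by rewrite {1}/z; ring.
have zE : z = t * x + (1 - t) * y by [].
move: (ln z) zl hx hy => l; lra.
Qed.

(* [ln (1 / sqrt x) <= 1 / sqrt x] *)
Lemma eta_le_sqrt x : 0 < x <= 1 -> `|eta x| <= 2 * Num.sqrt x.
Proof.
move=> /andP[x0 x1]; rewrite ger0_norm ?eta_ge0 //.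
have s0 : 0 < Num.sqrt x by rewrite sqrtr_gt0.
have xE : x = Num.sqrt x ^+ 2 by rewrite sqr_sqrtr // ltW.
have : ln (Num.sqrt x)^-1 <= (Num.sqrt x)^-1.
  by rewrite ltW // ln_sublinear // invr_gt0.
rewrite lnV ?posrE // => h.
rewrite /eta {1 2}xE lnXn // mulr2n; set s := Num.sqrt x in s0 xE h *.
have : 0 <= s ^+ 2 * (s^-1 + ln s) by rewrite mulr_ge0 ?sqr_ge0 //; lra.
have -> : s ^+ 2 * (s^-1 + ln s) = s + s ^+ 2 * ln s by field; rewrite gt_eqF.
lra.
Qed.

Lemma continuous_eta : continuous eta.
Proof.
move=> x; have [x0|x0|->] := ltgtP x 0.
- rewrite /continuous_at [eta x]eta_le0 ?ltW //; apply: cvg_near_cst.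
  near=> y; rewrite eta_le0 //.
  by near: y; exact: lt_le_nbhsl.
- by apply: cvgN; apply: cvgM; [exact: cvg_id|exact: continuous_ln].
- rewrite /continuous_at [eta 0]eta_le0 //; apply/cvgrPdist_lt => e e0; near=> y.
  rewrite sub0r normrN; have [y0|y0] := leP y 0; first by rewrite eta_le0 ?normr0.
  have yb : y < Num.min 1 ((e / 2) ^+ 2).
    near: y; apply: lt_nbhsl.
    by rewrite lt_min ltr01 exprn_gt0 // divr_gt0.
  move: yb; rewrite lt_min => /andP[y1 ye].
  apply: le_lt_trans (eta_le_sqrt _) _; first by rewrite y0 ltW.
  rewrite -ltr_pdivlMl // mulrC -(ltr_pXn2r (n := 2)) ?nnegrE ?sqrtr_ge0 //.
  + by rewrite sqr_sqrtr // ltW.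
  + by rewrite divr_ge0 // ltW.
Unshelve. all: by end_near. Qed.

Definition is_distr (A : finType) (p : A -> R) : Prop :=
  (forall a, 0 <= p a) /\ \sum_a p a = 1.

Lemma is_distr_le1 (A : finType) (p : A -> R) a : is_distr p -> p a <= 1.
Proof.
by move=> [p0 p1]; rewrite -p1 (bigD1 a) //= lerDl sumr_ge0.
Qed.

Definition entropy (A : finType) (p : A -> R) : R := \sum_a eta (p a).

Lemma entropy_ge0 (A : finType) (p : A -> R) : is_distr p -> 0 <= entropy p.
Proof. by move=> dp; apply: sumr_ge0 => a _; rewrite eta_ge0 // is_distr_le1. Qed.

Lemma shannon_entropyE (A : finType) (p : A -> R) :
  shannon_entropy p = entropy p / ln 2.
Proof.
rewrite /shannon_entropy /entropy mulr_suml -sumrN; apply: eq_bigr => a _.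
by rewrite /eta mulrA mulNr.
Qed.

End entropy.

(** * Powers of a distribution *)

Section growth.
Variable R : realType.

Lemma near_le_expR (c e : R) : 0 < e -> \forall n \near \oo, c <= expR (n%:R * e).
Proof.
move=> e0; near=> n; apply: le_trans (expR_ge1Dx _).
have : c / e <= n%:R by near: n; exact: nbhs_infty_ger.
by rewrite ler_pdivrMr // => h; lra.
Unshelve. all: by end_near. Qed.

Lemma near_exprn_le_expR m (e : R) : 0 < e ->
  \forall n \near \oo, n.+1%:R ^+ m <= expR (n%:R * e).
Proof.
move=> e0; near=> n.
have n0 : (0 < n)%N by near: n; exists 1%N.
have ne0 : 0 <= n%:R * e by rewrite mulr_ge0 // ltW.
(* From this [n] on, the Taylor term of degree [m.+1] of the exponential exceeds [(2 n) ^ m], which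
   bounds [n.+1 ^ m]. *)
have hn : 2 ^+ m * (m.+1)`!%:R / e ^+ m.+1 <= n%:R.
  by near: n; exact: nbhs_infty_ger.
apply: le_trans (le_trans _ (expR_ge1Dxn m ne0)).
  apply: (@le_trans _ _ ((2 * n%:R) ^+ m)); last exact: lexx.
  by rewrite lerXn2r ?nnegrE // -natrM ler_nat; lia.
apply: (@le_trans _ _ ((n%:R * e) ^+ m.+1 / m.+1`!%:R)); last by rewrite lerDr.
have f0 : 0 < (m.+1`!%:R : R) by rewrite ltr0n fact_gt0.
have -> : (n%:R * e) ^+ m.+1 / m.+1`!%:R = n%:R ^+ m * (n%:R * (e ^+ m.+1 / m.+1`!%:R)).
  by rewrite exprMn (exprS n%:R) -!mulrA mulrCA.
rewrite exprMn mulrC ler_pM2l ?exprn_gt0 ?ltr0n // mulrA ler_pdivlMr //.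
by move: hn; rewrite ler_pdivrMr ?exprn_gt0.
Unshelve. all: by end_near. Qed.

End growth.

Section iid.
Variable R : realType.

Definition iid (A : finType) n (p : A -> R) (a : {ffun 'I_n -> A}) : R :=
  \prod_k p (a k).

Lemma iid_ge0 (A : finType) n (p : A -> R) (a : {ffun 'I_n -> A}) :
  is_distr p -> 0 <= iid p a.
Proof. by move=> [p0 _]; exact: prodr_ge0. Qed.

Lemma sum_iid (A : finType) n (p : A -> R) (g : 'I_n -> A -> R) :
  \sum_a iid p a * \prod_k g k (a k) = \prod_k \sum_x p x * g k x.
Proof.
by rewrite bigA_distr_bigA; apply: eq_bigr => a _; rewrite /iid -big_split.
Qed.

Lemma sum_iid1 (A : finType) n (p : A -> R) :
  is_distr p -> \sum_(a : {ffun 'I_n -> A}) iid p a = 1.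
Proof.
move=> [_ p1]; transitivity (\prod_(k < n) \sum_x p x); last by rewrite big1.
by rewrite bigA_distr_bigA.
Qed.

Definition push (X A : finType) (f : X -> A) (P : X -> R) (a : A) : R :=
  \sum_(x | f x == a) P x.

Lemma is_distr_push (X A : finType) (f : X -> A) (P : X -> R) :
  is_distr P -> is_distr (push f P).
Proof.
move=> [P0 P1]; split=> [a|]; first exact: sumr_ge0.
by rewrite -P1 [RHS](partition_big f xpredT).
Qed.

(** Expanding the product of fibre sums yields exactly the words [J] that [f] maps letterwise to
    [a]. *)
Lemma sum_iid_push (X A : finType) (f : X -> A) (P : X -> R) n
    (V : {set {ffun 'I_n -> A}}) :
  \sum_(J : {ffun 'I_n -> X} | [ffun k => f (J k)] \in V) iid P J =
  \sum_(a in V) iid (push f P) a.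
Proof.
rewrite (partition_big (fun J : {ffun 'I_n -> X} => [ffun k => f (J k)]) (mem V)) //=.
apply: eq_bigr => a aV; rewrite /iid /push bigA_distr_big_dep.
apply: eq_bigl => J; apply/andP/familyP => [[_ /eqP <-] k|Ja].
  by rewrite unfold_in /= ffunE.
have -> : [ffun k => f (J k)] = a.
  by apply/ffunP => k; rewrite ffunE; apply/eqP; have := Ja k; rewrite unfold_in.
by rewrite aV.
Qed.

(** * Method of types *)

Section types.
Variables (A : finType) (n : nat).
Hypothesis n0 : (0 < n)%N.
Implicit Type a : {ffun 'I_n -> A}.

Definition occ a x : nat := #|[pred k | a k == x]|.

Definition empirical a x : R := (occ a x)%:R / n%:R.

Lemma sum_by_occ a (F : A -> R) : \sum_k F (a k) = \sum_x (occ a x)%:R * F x.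
Proof.
rewrite (partition_big a xpredT) //=; apply: eq_bigr => x _.
under eq_bigr => k /eqP -> do [].
by rewrite sumr_const mulr_natl.
Qed.

Let nR0 : (n%:R : R) != 0. Proof. by rewrite pnatr_eq0 -lt0n. Qed.

Lemma is_distr_empirical a : is_distr (empirical a).
Proof.
split=> [x|]; first by rewrite divr_ge0.
rewrite /empirical -mulr_suml.
under eq_bigr do rewrite -[(occ _ _)%:R]mulr1.
by rewrite -(sum_by_occ a (fun=> 1)) sumr_const card_ord divff.
Qed.

(** A letter of frequency [q] occurs [n q] times and thus contributes [n q ln q] to the logarithm of
    the product. *)
Lemma iid_empirical a : iid (empirical a) a = expR (- (n%:R * entropy (empirical a))).
Proof.
have pos k : 0 < empirical a (a k).
  by rewrite divr_gt0 ?ltr0n // /occ; apply/card_gt0P; exists k; rewrite inE /=.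
transitivity (\prod_k expR (ln (empirical a (a k)))).
  by apply: eq_bigr => k _; rewrite lnK // posrE.
rewrite -expR_sum (sum_by_occ a (fun x => ln (empirical a x))); congr expR.
rewrite /entropy mulr_sumr -sumrN; apply: eq_bigr => x _.
by rewrite /eta mulrN opprK mulrA {2}/empirical mulrCA divff // mulr1.
Qed.

Lemma occ_le a x : (occ a x <= n)%N.
Proof. by rewrite -[X in (_ <= X)%N]card_ord max_card. Qed.

(* Method of types: there are at most [n.+1 ^ #|A|] empirical distributions,
   and those with a given one have total mass at most 1 for its product. *)
Lemma card_low_entropy (V : {set {ffun 'I_n -> A}}) h :
  (forall a, a \in V -> entropy (empirical a) <= h) ->
  #|V|%:R <= n.+1%:R ^+ #|A| * expR (n%:R * h).
Proof.
move=> Vh; pose type a : {ffun A -> 'I_n.+1} := [ffun x => inord (occ a x)].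
have typeE a b : type a = type b -> empirical a = empirical b.
  move=> /ffunP ab; apply/funext => x; have := congr1 val (ab x).
  by rewrite !ffunE /empirical /= !inordK ?ltnS ?occ_le // => ->.
have -> : #|V|%:R = \sum_(a in V) (1 : R) by rewrite sumr_const.
(* The mass of a word under its own empirical distribution is at least [expR (- (n h))], so each
   summand is at least 1. *)
apply: (@le_trans _ _ (\sum_(a in V) expR (n%:R * h) * iid (empirical a) a)).
  apply: ler_sum => a aV; rewrite iid_empirical -expRD.
  rewrite -[leLHS]expR0 ler_expR subr_ge0 ler_pM2l ?ltr0n //; exact: Vh.
rewrite -mulr_sumr mulrC ler_pM2r ?expR_gt0 //.
rewrite (partition_big type xpredT) //=.
apply: (@le_trans _ _ (\sum_(t : {ffun A -> 'I_n.+1}) 1)); last first.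
  by rewrite sumr_const card_ffun card_ord natrX.
apply: ler_sum => t _.
have [a0 /eqP a0t|none] := pickP (fun a => type a == t); last first.
  by rewrite big_pred0 // => a; rewrite none andbF.
rewrite -(@sum_iid1 _ n _ (is_distr_empirical a0)).
rewrite [leRHS](bigID (fun a => (a \in V) && (type a == t))) /= ler_wpDr //.
  by apply: sumr_ge0 => a _; apply: iid_ge0; exact: is_distr_empirical.
by apply: ler_sum => a /andP[_ /eqP at0]; rewrite (typeE a a0) // a0t.
Qed.

End types.

(** * Concentration of the surprisal *)

Section concentration.
Variables (A : finType) (p : A -> R).
Hypothesis dp : is_distr p.

Lemma iid_covariance n (Y : A -> R) (k l : 'I_n) : \sum_x p x * Y x = 0 ->
  \sum_a iid p a * (Y (a k) * Y (a l)) = (\sum_x p x * Y x ^+ 2) *+ (k == l).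
Proof.
move=> Y0.
(* Writing [Y (a k) * Y (a l)] as a product over all positions lets the expectation factor; for
   distinct [k], [l] the factor at [k] is the mean of [Y]. *)
pose g j x := (if j == k then Y x else 1) * (if j == l then Y x else 1).
have gE (a : {ffun 'I_n -> A}) : \prod_j g j (a j) = Y (a k) * Y (a l).
  by rewrite big_split -!big_mkcond /= !big_pred1_eq.
under eq_bigr do rewrite -gE.
rewrite sum_iid (bigD1 k) //= /g eqxx; case: (k =P l) => [<-|kl].
  rewrite [X in _ * X]big1 ?mulr1; first by apply: eq_bigr => x _; rewrite expr2.
  move=> j /negbTE ->; rewrite -[RHS]dp.2; apply: eq_bigr => x _.
  by rewrite !mulr1.
by under eq_bigr do rewrite mulr1; rewrite Y0 mul0r.
Qed.

Lemma iid_variance n (Y : A -> R) : \sum_x p x * Y x = 0 ->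
  \sum_(a : {ffun 'I_n -> A}) iid p a * (\sum_k Y (a k)) ^+ 2 =
  n%:R * \sum_x p x * Y x ^+ 2.
Proof.
move=> Y0; transitivity (\sum_(k < n) \sum_(l < n)
    \sum_(a : {ffun 'I_n -> A}) iid p a * (Y (a k) * Y (a l))).
  under [RHS]eq_bigr do rewrite exchange_big /=.
  rewrite [RHS]exchange_big /=; apply: eq_bigr => a _.
  rewrite expr2 mulr_suml mulr_sumr; apply: eq_bigr => k _.
  by rewrite !mulr_sumr.
transitivity (\sum_(k < n) \sum_x p x * Y x ^+ 2); last first.
  by rewrite sumr_const card_ord mulr_natl.
apply: eq_bigr => k _; rewrite (bigD1 k) //= iid_covariance // eqxx mulr1n.
rewrite [X in _ + X]big1 ?addr0 // => l lk; rewrite iid_covariance //.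
by rewrite eq_sym (negbTE lk).
Qed.

(** The information content of a letter, centred at its mean. *)
Let surprise x : R := - ln (p x) - entropy p.

(** Pointwise form of Chebyshev's inequality: if the mass of [a] exceeds the first term, its
    surprises sum to less than [- n e], so the quotient of squares is at least 1. *)
Lemma iid_le_deviation n (e : R) (a : {ffun 'I_n -> A}) : (0 < n)%N -> 0 < e ->
  iid p a <= expR (- (n%:R * (entropy p - e))) +
             iid p a * (\sum_k surprise (a k)) ^+ 2 / (n%:R * e) ^+ 2.
Proof.
move=> n0 e0; set q := expR _; set D := (_ * e) ^+ 2.
have nR : 0 < (n%:R : R) by rewrite ltr0n.
have D0 : 0 < D by rewrite exprn_gt0 // mulr_gt0.
have ia0 := iid_ge0 a dp.
have t0 : 0 <= iid p a * (\sum_k surprise (a k)) ^+ 2 / D.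
  by rewrite divr_ge0 ?(ltW D0) // mulr_ge0 ?sqr_ge0.
have [le|gt] := leP (iid p a) q; first by rewrite ler_wpDr.
rewrite ler_wpDl ?expR_ge0 // -mulrA ler_peMr //.
have ia : 0 < iid p a by apply: lt_trans gt; exact: expR_gt0.
have pa k : 0 < p (a k).
  rewrite lt_neqAle dp.1 andbT eq_sym; apply: contraTneq ia => pk.
  by rewrite /iid (bigD1 k) //= pk mul0r ltxx.
have : expR (\sum_k ln (p (a k))) = iid p a.
  by rewrite expR_sum; apply: eq_bigr => k _; rewrite lnK // posrE.
move=> iaE; move: gt; rewrite -iaE ltr_expR => lt.
have sE : \sum_k surprise (a k) = - (\sum_k ln (p (a k))) - n%:R * entropy p.
  by rewrite /surprise sumrB sumrN sumr_const card_ord mulr_natl.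
rewrite ler_pdivlMr // mul1r /D -[leRHS]sqrrN ler_pXn2r ?nnegrE //; first by rewrite sE; lra.
- by rewrite mulr_ge0 // ltW.
- by rewrite sE; have : 0 <= n%:R * e by [rewrite mulr_ge0 // ltW]; lra.
Qed.

Let variance : R := \sum_x p x * surprise x ^+ 2.

Lemma sum_surprise : \sum_x p x * surprise x = 0.
Proof.
rewrite /surprise; under eq_bigr do rewrite mulrBr mulrN.
by rewrite sumrB -mulr_suml dp.2 mul1r subrr.
Qed.

Lemma iid_mass_le n (e : R) (V : {set {ffun 'I_n -> A}}) : (0 < n)%N -> 0 < e ->
  \sum_(a in V) iid p a <=
  #|V|%:R * expR (- (n%:R * (entropy p - e))) + variance / (n%:R * e ^+ 2).
Proof.
move=> n0 e0; have nR : 0 < (n%:R : R) by rewrite ltr0n.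
set q := expR _.
have D0 : 0 < (n%:R * e) ^+ 2 by rewrite exprn_gt0 // mulr_gt0.
pose d (a : {ffun 'I_n -> A}) := iid p a * (\sum_k surprise (a k)) ^+ 2.
have d0 a : 0 <= d a by rewrite mulr_ge0 ?sqr_ge0 // iid_ge0.
apply: (@le_trans _ _ (\sum_(a in V) (q + d a / (n%:R * e) ^+ 2))).
  by apply: ler_sum => a _; exact: iid_le_deviation.
rewrite big_split /= sumr_const -[q *+ _]mulr_natl lerD2l.
apply: (@le_trans _ _ (\sum_a d a / (n%:R * e) ^+ 2)).
  rewrite [leRHS](bigID (mem V)) /= lerDl; apply: sumr_ge0 => a _.
  by rewrite divr_ge0 // ltW.
rewrite -mulr_suml (iid_variance _ sum_surprise) -/variance.
rewrite exprMn expr2 -!mulrA invfM mulrCA [n%:R * (n%:R^-1 * _)]mulrA divff ?gt_eqF //.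
by rewrite mul1r.
Qed.

Lemma near_card_ge_entropy (e : R) : 0 < e ->
  \forall n \near \oo, forall V : {set {ffun 'I_n -> A}},
    3^-1 <= \sum_(a in V) iid p a -> expR (n%:R * (entropy p - e)) <= #|V|%:R.
Proof.
move=> e0; have e20 : 0 < e / 2 by rewrite divr_gt0.
(* Atypical words take at most 1/6 of the mass 1/3. The typical ones keep 1/6, and one half of [e]
   absorbs the factor 6. *)
suff key n (V : {set {ffun 'I_n -> A}}) : (0 < n)%N ->
    6 * variance / (e / 2) ^+ 2 <= n%:R -> 6 <= expR (n%:R * (e / 2)) ->
    3^-1 <= \sum_(a in V) iid p a -> expR (n%:R * (entropy p - e)) <= #|V|%:R.
  near=> n => V; apply: key.
  - by near: n; exists 1%N.
  - by near: n; exact: nbhs_infty_ger.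
  - by near: n; exact: near_le_expR.
move=> n0 hn hexp /le_trans/(_ (iid_mass_le V n0 e20)).
have nR : 0 < (n%:R : R) by rewrite ltr0n.
have small : variance / (n%:R * (e / 2) ^+ 2) <= 6^-1.
  rewrite ler_pdivrMr ?mulr_gt0 ?exprn_gt0 //.
  by move: hn; rewrite ler_pdivrMr ?exprn_gt0 //; lra.
set q := expR (- _) => big.
have Vq : 1 <= #|V|%:R * (6 * q) by rewrite mulrCA; lra.
rewrite -[leLHS]mul1r -ler_pdivlMr ?expR_gt0 // -expRN.
apply: (le_trans Vq); rewrite ler_wpM2l //.
have -> : - (n%:R * (entropy p - e)) = n%:R * (e / 2) + - (n%:R * (entropy p - e / 2)).
  by lra.
by rewrite expRD ler_pM2r ?expR_gt0.
Unshelve. all: by end_near. Qed.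

End concentration.

End iid.

(** * Asymptotic slice size *)

Section support_distributions.
Variables (R : realType) (K : fieldType) (A B C : finType) (T : tensor K A B C).
Implicit Types (P Q : A * B * C -> R) (i : 'I_3).

Local Notation Delta := (distribution_on (supp T) : set (A * B * C -> R)).

Definition pi1 (j : A * B * C) : A := j.1.1.
Definition pi2 (j : A * B * C) : B := j.1.2.
Definition pi3 (j : A * B * C) : C := j.2.

Lemma sum_triple P : \sum_x P x = \sum_a \sum_b \sum_c P (a, b, c).
Proof. by rewrite pair_bigA pair_bigA; apply: eq_bigr => -[[]]. Qed.

Lemma marginalsE P : marginals P = (push pi1 P, push pi2 P, push pi3 P).
Proof.
congr (_, _, _); apply/funext => x;
  rewrite /push [RHS]big_mkcond [RHS]sum_triple; symmetry.
- rewrite (bigD1 x) //= [X in _ + X]big1 ?addr0 => [|a /negbTE ax].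
    by apply: eq_bigr => b _; apply: eq_bigr => c _; rewrite /pi1 eqxx.
  by rewrite big1 // => b _; rewrite big1 // => c _; rewrite /pi1 /= ax.
- apply: eq_bigr => a _.
  rewrite (bigD1 x) //= [X in _ + X]big1 ?addr0 => [|b /negbTE bx].
    by apply: eq_bigr => c _; rewrite /pi2 eqxx.
  by rewrite big1 // => c _; rewrite /pi2 /= bx.
- apply: eq_bigr => a _; apply: eq_bigr => b _.
  rewrite (bigD1 x) //= [X in _ + X]big1 ?addr0 => [|c /negbTE cx].
    by rewrite /pi3 eqxx.
  by rewrite /pi3 /= cx.
Qed.

(** Entropies use the natural logarithm; the base 2 of the support functional cancels in
    [support_functionalE]. *)
Definition ent P i : R :=
  tnth [tuple entropy (push pi1 P); entropy (push pi2 P); entropy (push pi3 P)] i.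

Lemma Delta_distr P : Delta P -> is_distr P.
Proof. by case. Qed.

Lemma ent_ge0 P i : Delta P -> 0 <= ent P i.
Proof.
by move=> /Delta_distr dP; move: i; apply: ord3_ind; rewrite /ent /=;
  apply/entropy_ge0/is_distr_push.
Qed.

Definition mix_fun (t : R) P Q : A * B * C -> R :=
  fun x => t * P x + (1 - t) * Q x.

Lemma Delta_mix : mix_closed mix_fun Delta.
Proof.
move=> t P Q /andP[t0 t1] [P0 P1 Ps] [Q0 Q1 Qs]; split.
- by move=> x; rewrite addr_ge0 // mulr_ge0 // subr_ge0.
- by rewrite big_split -!mulr_sumr /= P1 Q1; lra.
- by move=> x xT; rewrite /mix_fun Ps // Qs // !mulr0 addr0.
Qed.

Lemma entropy_push_concave (X : finType) (f : A * B * C -> X) :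
  concave_on mix_fun Delta (fun P => entropy (push f P)).
Proof.
move=> t P Q t01 /Delta_distr dP /Delta_distr dQ.
rewrite /entropy !mulr_sumr -big_split; apply: ler_sum => x _.
have -> : push f (mix_fun t P Q) x = t * push f P x + (1 - t) * push f Q x.
  by rewrite /push big_split -!mulr_sumr.
by apply: eta_concave => //; apply: (is_distr_push _ _).1.
Qed.

Lemma ent_concave i : concave_on mix_fun Delta (ent ^~ i).
Proof. by move: i; apply: ord3_ind; exact: entropy_push_concave. Qed.

(** Distributions are parametrized by row vectors, where compactness and the extreme value theorem
    apply. *)
Definition of_row (v : 'rV[R]_#|{: A * B * C}|) : A * B * C -> R :=
  fun x => v ord0 (enum_rank x).

Lemma continuous_entropy_push (X : finType) (f : A * B * C -> X) :
  continuous (fun v => entropy (push f (of_row v))).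
Proof.
apply: continuous_big => [|a _]; first exact: add_continuous.
have cpush : continuous (fun v => push f (of_row v) a : R).
  apply: continuous_big => [|x _]; first exact: add_continuous.
  exact: coord_continuous.
by move=> v; exact: (continuous_comp (cpush v) (@continuous_eta R _)).
Qed.

Lemma continuous_ent i : continuous (fun v => ent (of_row v) i).
Proof. by move: i; apply: ord3_ind; exact: continuous_entropy_push. Qed.

Lemma Delta_nonempty : T <> 0 -> exists P, Delta P.
Proof.
move=> T0; have [j Tj|none] := pickP (fun j => T j != 0); last first.
  by case: T0; apply/ffunP => j; rewrite ffunE; apply/eqP/negPn; rewrite none.
exists (fun x => (x == j)%:R); split=> [x||x].
- exact: ler0n.
- by rewrite (bigD1 j) //= eqxx big1 ?addr0 // => x /negbTE ->.
- by case: eqP => // ->.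
Qed.

Lemma Delta_max (Phi : (A * B * C -> R) -> R) : T <> 0 ->
  continuous (fun v => Phi (of_row v)) ->
  exists2 P, Delta P & forall Q, Delta Q -> Phi Q <= Phi P.
Proof.
move=> T0 cPhi.
(* The distributions on the support form a product of compact sets, degenerate off the support, cut
   by the closed condition of total mass 1. *)
pose box (k : 'I_#|{: A * B * C}|) : set R :=
  if T (enum_val k) == 0 then [set 0] else `[0, 1]%classic.
pose D := [set v : 'rV[R]_#|{: A * B * C}| | forall k, box k (v ord0 k)] `&`
  [set v : 'rV[R]_#|{: A * B * C}| | \sum_x of_row v x = 1].
have rowK P : of_row (\row_k P (enum_val k)) = P.
  by apply/funext => x; rewrite /of_row mxE enum_rankK.
have DP P : Delta P -> D (\row_k P (enum_val k)).
  move=> dP; case: (dP) => P0 P1 Ps; split; last by rewrite /= rowK.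
  move=> k /=; rewrite mxE /box; case: eqP => [Tk|_]; first by rewrite Ps // /supp /= Tk eqxx.
  by rewrite /= in_itv /= P0 (is_distr_le1 _ (Delta_distr dP)).
have PD v : D v -> Delta (of_row v).
  move=> [vbox v1]; split=> // x; have := vbox (enum_rank x);
    rewrite /box enum_rankK /of_row.
    by case: ifP => _ /=; [move=> -> | rewrite in_itv /= => /andP[]].
  by rewrite /supp /=; case: eqP => [_ /= -> //|_ _ []].
have D0 : D !=set0.
  by have [P /DP] := Delta_nonempty T0; eexists; eassumption.
have Dc : compact D.
  apply: compact_closedI.
    apply: rV_compact => k; rewrite /box; case: ifP => _.
      exact: compact_set1.
    exact: segment_compact.
  apply: (@preimage_closed _ _ (fun v => \sum_x of_row v x) [set 1]).
    move=> v _; apply: continuous_big => [|x _]; first exact: add_continuous.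
    exact: coord_continuous.
  exact: closed_eq.
have [v vD vmax] := EVT_max_rV D0 Dc (continuous_subspaceT cPhi).
exists (of_row v); first by apply: PD; rewrite inE in vD.
move=> Q dQ; rewrite -(rowK Q); apply: vmax; rewrite inE; exact: DP.
Qed.

Lemma support_functionalE (theta : 'I_3 -> R) : T <> 0 ->
  exists2 P, Delta P & support_functional theta T = expR (\sum_i theta i * ent P i)
    /\ forall Q, Delta Q -> \sum_i theta i * ent Q i <= \sum_i theta i * ent P i.
Proof.
move=> T0; have [||P dP Pmax] := @Delta_max (fun P => \sum_i theta i * ent P i) => //.
  apply: continuous_big => [|i _]; first exact: add_continuous.
  by move=> v; exact: (cvgM (cvg_cst (theta i)) (@continuous_ent i v)).
exists P => //; split=> //.
have valE Q : 2 `^ (\sum_i theta i * tnth [tuple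
    shannon_entropy (marginals Q).1.1; shannon_entropy (marginals Q).1.2;
    shannon_entropy (marginals Q).2] i) = expR (\sum_i theta i * ent Q i).
  have ln2 : 0 < ln 2 :> R by rewrite ln_gt0 // ltr1n.
  rewrite -{1}[2](@lnK R) ?posrE // -expRM; congr expR.
  rewrite !big_ord3 /ent marginalsE /= !shannon_entropyE.
  by rewrite !(tnth_nth 0) /=; field; rewrite gt_eqF.
apply/eqP; rewrite eq_le; apply/andP; split.
  apply: ge_sup => [|_ [p [Q dQ <-] <-]].
    by eexists; exists (marginals P); first exists P.
  by rewrite valE ler_expR Pmax.
apply: ub_le_sup.
  exists (expR (\sum_i theta i * ent P i)) => _ [p [Q dQ <-] <-].
  by rewrite valE ler_expR Pmax.
by exists (marginals P); [exists P|rewrite valE].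
Qed.

End support_distributions.

(** * Bounds on the slice size *)

Section slice_size_bounds.
Variables (R : realType) (K : fieldType) (A B C : finType).
Implicit Types (T : tensor K A B C) (xi : 'I_3 -> R).

Definition cards (V1 : {set A}) (V2 : {set B}) (V3 : {set C}) (i : 'I_3) : nat :=
  tnth [tuple #|V1|; #|V2|; #|V3|] i.

Lemma decomposition_of_cover V1 V2 V3 T : vertex_cover V1 V2 V3 T ->
  exists2 r, has_slice_decomposition r T & forall i, (r i <= cards V1 V2 V3 i)%N.
Proof.
move=> /slice_decomposition_of_cover[r rT [r1 r2 r3]].
by exists r => //; apply: ord3_ind.
Qed.

Lemma cover_of_decomposition T r : tight T -> has_slice_decomposition r T ->
  exists V1 V2 V3, vertex_cover V1 V2 V3 T /\
    forall i, (cards V1 V2 V3 i <= r i)%N.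
Proof.
move=> tT /(cover_of_slice_decomposition tT)[V1 [V2 [V3 [c1 c2 c3 cov]]]].
by exists V1, V2, V3; split=> //; apply: ord3_ind.
Qed.

Lemma slice_size_set_lbound xi T :
  lbound [set \sum_(i | xi i != 0) (r i)%:R `^ (xi i)^-1
      | r in [set r : 'I_3 -> nat | has_slice_decomposition r T /\
                                    forall i, xi i = 0 -> r i = 0%N]] 0.
Proof. by move=> _ [r _ <-]; apply: sumr_ge0 => i _; exact: powR_ge0. Qed.

Lemma slice_size_le xi T V1 V2 V3 (c : R) : (forall i, 0 <= xi i) -> 0 <= c ->
  vertex_cover V1 V2 V3 T ->
  (forall i, xi i = 0 -> cards V1 V2 V3 i = 0%N) ->
  (forall i, xi i != 0 -> (cards V1 V2 V3 i)%:R `^ (xi i)^-1 <= c) ->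
  slice_size xi T <= 3 * c.
Proof.
move=> xi0 c0 /decomposition_of_cover[r rT rV] V0 Vc.
apply: (@le_trans _ _ (\sum_(i | xi i != 0) (r i)%:R `^ (xi i)^-1)).
  apply: ge_inf; first by exists 0; exact: slice_size_set_lbound.
  exists r => //; split=> // i /V0 Vi0; apply/eqP.
  by rewrite -leqn0 -Vi0.
apply: (@le_trans _ _ (\sum_(i < 3) c)); last first.
  by rewrite sumr_const card_ord mulr_natl.
rewrite big_mkcond; apply: ler_sum => i _; case: ifPn => // xin.
apply: le_trans (Vc i xin); apply: ge0_ler_powR; rewrite ?nnegrE ?invr_ge0 //.
by rewrite ler_nat.
Qed.

Lemma slice_size_ge xi T (c : R) i0 : xi i0 != 0 ->
  (forall r, has_slice_decomposition r T -> (forall i, xi i = 0 -> r i = 0%N) ->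
    exists2 i, xi i != 0 & c <= (r i)%:R `^ (xi i)^-1) ->
  c <= slice_size xi T.
Proof.
move=> xin rc; apply: lb_le_inf => [|_ [r [rT r0] <-]].
  (* The infimum is bounded below through its elements only if there are some: the whole factor [i0]
     is a cover, and its slices are admissible as [xi i0 != 0]. *)
  have cov : vertex_cover (if i0 == o0 then [set: A] else finset.set0)%SET
     (if i0 == o1 then [set: B] else finset.set0)%SET
     (if i0 == o2 then [set: C] else finset.set0)%SET T.
    by move=> j _; move: i0 {xin}; apply: ord3_ind; rewrite ?inE ?orbT.
  have [r rT rV] := decomposition_of_cover cov.
  eexists; exists r; last by reflexivity.
  split=> // i xi0; apply/eqP; rewrite -leqn0; apply: leq_trans (rV i) _.
  have : i != i0 by apply: contraNneq xin => <-; apply/eqP.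
  by move: i i0 {xin xi0 cov rV}; do 2 apply: ord3_ind => //; rewrite /cards !(tnth_nth 0) /= ?cards0.
have [i xi0 ci] := rc r rT r0.
apply: (le_trans ci); rewrite (bigD1 i) //= lerDl.
by apply: sumr_ge0 => k _; exact: powR_ge0.
Qed.

End slice_size_bounds.

(** * Growth rate of the slice size of powers *)

Section asymptotics.
Variables (R : realType) (K : fieldType) (A B C : finType) (T : tensor K A B C).
Implicit Types (xi : 'I_3 -> R).

Local Notation Delta := (distribution_on (supp T) : set (A * B * C -> R)).

Lemma push_empirical (X Y : finType) (f : X -> Y) n (J : {ffun 'I_n -> X}) :
  push f (empirical R J) = empirical R [ffun k => f (J k)].
Proof.
apply/funext => y; rewrite /push /empirical -mulr_suml -natr_sum; congr (_%:R / _).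
rewrite /occ -sum1_card (partition_big J (fun x => f x == y)) /=; last first.
  by move=> k; rewrite inE ffunE.
apply: eq_bigr => x fxy; rewrite -sum1_card; apply: eq_bigl => k.
by rewrite !inE ffunE andbC; case: eqP => // ->; rewrite fxy.
Qed.

(** A word of nonzero mass has all its letters in the support of [T], so it is covered; the claim is
    then a union bound. *)
Lemma vertex_cover_mass n V1 V2 V3 (P : A * B * C -> R) :
  vertex_cover V1 V2 V3 (kronecker_pow T n) -> Delta P ->
  1 <= \sum_(a in V1) iid (push (@pi1 A B C) P) a +
       \sum_(a in V2) iid (push (@pi2 A B C) P) a +
       \sum_(a in V3) iid (push (@pi3 A B C) P) a.
Proof.
move=> cov dP; have [_ _ Ps] := dP; have iidP := Delta_distr dP.
rewrite -(sum_iid1 n iidP) -!sum_iid_push.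
rewrite [X in _ <= X + _ + _]big_mkcond [X in _ <= _ + X + _]big_mkcond.
rewrite [X in _ <= _ + X]big_mkcond -!big_split /=; apply: ler_sum => J _.
set b1 := _ \in V1; set b2 := _ \in V2; set b3 := _ \in V3.
have J0 := iid_ge0 J iidP.
have [->|Jn] := eqVneq (iid P J) 0; first by case: b1 b2 b3 => -[] [] /=; lra.
suff : [|| b1, b2 | b3] by case: b1 b2 b3 => -[] [] //= _; lra.
apply: (cov ([ffun k => pi1 (J k)], [ffun k => pi2 (J k)], [ffun k => pi3 (J k)])).
apply/supp_kronecker_pow => k /=; rewrite !ffunE.
rewrite (_ : (_, _, _) = J k) /pi1 /pi2 /pi3; last by case: (J k) => -[].
have [//|/Ps Pk] := pselect (supp T (J k)).
by move: Jn; rewrite /iid (bigD1 k) //= Pk mul0r eqxx.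
Qed.

Lemma near_cover_cards (P : A * B * C -> R) (e : 'I_3 -> R) :
  Delta P -> (forall i, 0 < e i) ->
  \forall n \near \oo, forall V1 V2 V3,
    vertex_cover V1 V2 V3 (kronecker_pow T n) ->
    exists i, expR (n%:R * (ent P i - e i)) <= (cards V1 V2 V3 i)%:R.
Proof.
move=> dP e0; have dP' := Delta_distr dP.
have N1 := near_card_ge_entropy (is_distr_push (@pi1 A B C) dP') (e0 o0).
have N2 := near_card_ge_entropy (is_distr_push (@pi2 A B C) dP') (e0 o1).
have N3 := near_card_ge_entropy (is_distr_push (@pi3 A B C) dP') (e0 o2).
apply: filterS3 N1 N2 N3 => n n1 n2 n3 V1 V2 V3 cov.
have := vertex_cover_mass cov dP.
set s1 := bigop _ _ _; set s2 := bigop _ _ _; set s3 := bigop _ _ _ => s123.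
have [h1|h1] := leP 3^-1 s1; first by exists o0; exact: n1.
have [h2|h2] := leP 3^-1 s2; first by exists o1; exact: n2.
have [h3|h3] := leP 3^-1 s3; first by exists o2; exact: n3.
exfalso; lra.
Qed.

Lemma near_slice_size_ge xi i0 (P : A * B * C -> R) (g e : R) :
  tight T -> (forall i, 0 <= xi i) -> xi i0 != 0 -> Delta P ->
  (forall i, xi i != 0 -> xi i * g <= ent P i) -> 0 < e ->
  \forall n \near \oo, expR (n%:R * (g - e)) <= slice_size xi (kronecker_pow T n).
Proof.
move=> tT xi0 xin dP Pg e0.
(* The loss is scaled by [xi i] so that the exponent [1 / xi i] turns it into [e]; the value 1 only
   ensures positivity. *)
pose ei i := if xi i == 0 then 1 else e * xi i.
have xip i : xi i != 0 -> 0 < xi i by move=> h; rewrite lt_neqAle eq_sym h xi0.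
have ei0 i : 0 < ei i by rewrite /ei; case: ifPn => // /xip; exact: mulr_gt0.
apply: filterS (near_cover_cards dP ei0) => n hn.
apply: (slice_size_ge xin) => r rT r0.
have [V1 [V2 [V3 [cov Vr]]]] := cover_of_decomposition (tight_kronecker_pow n tT) rT.
have [i hi] := hn _ _ _ cov; have {hi}ri := le_trans hi (_ : _ <= (r i)%:R).
have {}ri : expR (n%:R * (ent P i - ei i)) <= (r i)%:R.
  by apply: ri; rewrite ler_nat.
(* An index with [xi i = 0] has [r i = 0], against the positive lower bound. *)
have [xiz|xinz] := eqVneq (xi i) 0.
  by move: ri; rewrite (r0 i xiz) leNgt expR_gt0.
exists i => //.
have -> : expR (n%:R * (g - e)) = expR (xi i * (n%:R * (g - e))) `^ (xi i)^-1.
  by rewrite -expRM; congr expR; rewrite mulrAC divff // mul1r.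
apply: ge0_ler_powR; rewrite ?nnegrE ?invr_ge0 ?expR_ge0 //.
apply: le_trans ri; rewrite ler_expR mulrCA ler_wpM2l //.
by rewrite /ei (negbTE xinz) mulrBr [e * _]mulrC lerD2r Pg.
Qed.

Lemma Delta_empirical n (J : {ffun 'I_n -> A * B * C}) : (0 < n)%N ->
  (forall k, supp T (J k)) -> Delta (empirical R J).
Proof.
move=> n0 JT; have [E0 E1] := is_distr_empirical R n0 J; split=> // x xT.
rewrite /empirical /occ eq_card0 ?mul0r // => k; rewrite inE.
by apply/negP => /eqP Jk; apply: xT; rewrite -Jk.
Qed.

Lemma near_slice_size_le xi (g e : R) : (forall i, 0 <= xi i) ->
  (forall Q, Delta Q -> exists2 i, xi i != 0 & ent Q i <= xi i * g) -> 0 < e ->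
  \forall n \near \oo, slice_size xi (kronecker_pow T n) <= expR (n%:R * (g + e)).
Proof.
move=> xi0 Qg e0; have e20 : 0 < e / 2 by rewrite divr_gt0.
(* One half of [e] pays for the number of types, the other for the factor 3 from the three kinds of
   slices. *)
pose ei i := if xi i == 0 then 1 else e / 2 * xi i.
have xip i : xi i != 0 -> 0 < xi i by move=> h; rewrite lt_neqAle eq_sym h xi0.
have ei0 i : 0 < ei i by rewrite /ei; case: ifPn => // /xip; exact: mulr_gt0.
suff key n : (0 < n)%N -> 3 <= expR (n%:R * (e / 2)) ->
    n.+1%:R ^+ #|A| <= expR (n%:R * ei o0) ->
    n.+1%:R ^+ #|B| <= expR (n%:R * ei o1) ->
    n.+1%:R ^+ #|C| <= expR (n%:R * ei o2) ->
    slice_size xi (kronecker_pow T n) <= expR (n%:R * (g + e)).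
  near=> n; apply: key.
  - by near: n; exists 1%N.
  - by near: n; exact: near_le_expR.
  - by near: n; exact: near_exprn_le_expR.
  - by near: n; exact: near_exprn_le_expR.
  - by near: n; exact: near_exprn_le_expR.
move=> n0 n3 nA nB nC.
(* The condition [xi i != 0] empties the parts whose slices are forbidden; [Qg] ensures that the
   others still cover. *)
pose low (X : finType) i : {set {ffun 'I_n -> X}} :=
  [set a | (xi i != 0) && (entropy (empirical R a) <= xi i * g)]%SET.
have cov : vertex_cover (low A o0) (low B o1) (low C o2) (kronecker_pow T n).
  move=> j /supp_kronecker_pow jT.
  pose J : {ffun 'I_n -> A * B * C} := [ffun k => (j.1.1 k, j.1.2 k, j.2 k)].
  have dJ : Delta (empirical R J) by apply: Delta_empirical => // k; rewrite ffunE.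
  have [i xin] := Qg _ dJ.
  have j1 : [ffun k => pi1 (J k)] = j.1.1 by apply/ffunP => k; rewrite !ffunE.
  have j2 : [ffun k => pi2 (J k)] = j.1.2 by apply/ffunP => k; rewrite !ffunE.
  have j3 : [ffun k => pi3 (J k)] = j.2 by apply/ffunP => k; rewrite !ffunE.
  move: i xin; apply: ord3_ind => xin; rewrite /ent !(tnth_nth 0) /= push_empirical.
  - by rewrite j1 => h; rewrite !inE xin h.
  - by rewrite j2 => h; rewrite !inE xin h orbT.
  - by rewrite j3 => h; rewrite !inE xin h !orbT.
have low0 (X : finType) i : xi i = 0 -> #|low X i| = 0%N.
  by move=> xiz; apply: eq_card0 => a; rewrite !inE xiz eqxx.
have card_low (X : finType) i : xi i != 0 -> n.+1%:R ^+ #|X| <= expR (n%:R * ei i) ->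
    #|low X i|%:R `^ (xi i)^-1 <= expR (n%:R * (g + e / 2)).
  move=> xin nX.
  have -> : expR (n%:R * (g + e / 2)) =
      expR (xi i * (n%:R * (g + e / 2))) `^ (xi i)^-1.
    by rewrite -expRM; congr expR; rewrite mulrAC divff // mul1r.
  apply: ge0_ler_powR; rewrite ?nnegrE ?invr_ge0 ?expR_ge0 //.
  apply: le_trans (@card_low_entropy R X n n0 _ (xi i * g) _) _.
    by move=> a; rewrite inE => /andP[].
  have -> : xi i * (n%:R * (g + e / 2)) = n%:R * ei i + n%:R * (xi i * g).
    by rewrite /ei (negbTE xin); ring.
  by rewrite expRD ler_wpM2r ?expR_ge0.
apply: (@le_trans _ _ (3 * expR (n%:R * (g + e / 2)))).
  apply: slice_size_le cov _ _; rewrite ?expR_ge0 //.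
    by apply: ord3_ind; exact: low0.
  by apply: ord3_ind => xin; exact: card_low.
have -> : n%:R * (g + e) = n%:R * (e / 2) + n%:R * (g + e / 2) by lra.
by rewrite expRD ler_wpM2r ?expR_ge0.
Unshelve. all: by end_near. Qed.

(** The bounds squeeze [ln (s n) / n] to [g]. The lower one also makes [s n] positive, so
    exponentiating recovers the root. *)
Lemma limn_sup_root (s : nat -> R) (g : R) :
  (forall e : R, 0 < e -> \forall n \near \oo,
    expR (n%:R * (g - e)) <= s n <= expR (n%:R * (g + e))) ->
  limn_sup (fun n => s n `^ n%:R^-1) = expR g.
Proof.
move=> hs; apply: (cvg_limn_inf_sup _).2.
have lncvg : (fun n => ln (s n `^ n%:R^-1)) @ \oo --> g.
  apply/cvgrPdist_le => e e0; near=> n.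
  have n0 : (0 < n)%N by near: n; exists 1%N.
  have nR : 0 < (n%:R : R) by rewrite ltr0n.
  have /andP[lo hi] : expR (n%:R * (g - e)) <= s n <= expR (n%:R * (g + e)).
    by near: n; exact: hs.
  have sp : 0 < s n by apply: lt_le_trans lo; exact: expR_gt0.
  have [l1 l2] : n%:R * (g - e) <= ln (s n) /\ ln (s n) <= n%:R * (g + e).
    by rewrite -[n%:R * (g - e)]expRK -[n%:R * (g + e)]expRK !ler_ln ?posrE ?expR_gt0.
  rewrite ln_powR ler_norml; apply/andP; split.
    have : n%:R^-1 * ln (s n) <= g + e by rewrite ler_pdivrMl.
    by move: (n%:R^-1 * _) => ?; lra.
  have : g - e <= n%:R^-1 * ln (s n) by rewrite ler_pdivlMl.
  by move: (n%:R^-1 * _) => ?; lra.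
have Ecvg := continuous_cvg _ (@continuous_expR R g) lncvg.
suff eqn : \forall n \near \oo, expR (ln (s n `^ n%:R^-1)) = s n `^ n%:R^-1.
  move=> N /Ecvg EN; by apply: filterS2 eqn EN => n /= ->.
near=> n.
have /andP[lo _] : expR (n%:R * (g - 1)) <= s n <= expR (n%:R * (g + 1)).
  by near: n; exact: hs.
by rewrite lnK // posrE powR_gt0 // (lt_le_trans _ lo) // expR_gt0.
Unshelve. all: by end_near. Qed.

Lemma XiP xi : Xi xi <->
  [/\ forall i, 0 <= xi i, forall i, xi i <= 1 & exists i, xi i = 1].
Proof.
split=> [[xi0 xi1]|[xi0 xi1 [i xii]]].
  split=> // [i|]; first by rewrite -xi1 le_bigmax.
  exists [arg max_(i > o0) xi i]%O.
  by rewrite -xi1 (@bigmax_eq_arg _ _ _ 0 o0 xpredT).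
split=> //; apply/eqP; rewrite eq_le; apply/andP; split.
  by apply: bigmax_le => // ? _.
by rewrite -[leLHS]xii le_bigmax.
Qed.

(* [expR g] is the max-min value of [ent P i / xi i] over [xi i != 0]. *)
Lemma asymptotic_slice_sizeE xi : T <> 0 -> tight T -> Xi xi ->
  exists P g, [/\ Delta P, forall i, xi i != 0 -> xi i * g <= ent P i,
    forall Q, Delta Q -> exists2 i, xi i != 0 & ent Q i <= xi i * g &
    asymptotic_slice_size xi T = expR g].
Proof.
move=> T0 tT /XiP[xi0 _ [i0 xi1]].
have xin0 : xi i0 != 0 by rewrite xi1 oner_neq0.
(* Indices with [xi i = 0] are redirected to [i0], so that a minimum of three terms ranges exactly
   over the nonzero [xi i]. *)
pose iota i := if xi i != 0 then i else i0.
have iotan i : xi (iota i) != 0 by rewrite /iota; case: ifP.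
have xip i : xi i != 0 -> 0 < xi i by move=> h; rewrite lt_neqAle eq_sym h xi0.
pose h i (P : A * B * C -> R) := ent P (iota i) / xi (iota i).
have ch i : continuous (fun v => h i (of_row v)).
  by move=> v; exact: (cvgM (@continuous_ent R A B C (iota i) v) (cvg_cst _)).
have [|P dP Pmax] := @Delta_max R K A B C T
    (fun P => Num.min (h o0 P) (Num.min (h o1 P) (h o2 P))) T0.
  by move=> v; exact: (continuous_min (ch o0 v) (continuous_min (ch o1 v) (ch o2 v))).
set g := Num.min _ _ in Pmax.
have Pg i : xi i != 0 -> xi i * g <= ent P i.
  move=> xin; rewrite mulrC -ler_pdivlMr ?xip //.
  have -> : ent P i / xi i = h i P by rewrite /h /iota xin.
  by move: i {xin}; apply: ord3_ind; rewrite /g !ge_min lexx ?orbT.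
have Qg Q : Delta Q -> exists2 i, xi i != 0 & ent Q i <= xi i * g.
  move=> /Pmax Qg; suff [i hi] : exists i, h i Q <= g.
    by exists (iota i) => //; rewrite mulrC -ler_pdivrMr ?xip.
  by move: Qg; rewrite !ge_min => /or3P[]; eexists; eassumption.
exists P, g; split=> //; apply: limn_sup_root => e e0.
near=> n; apply/andP; split; near: n.
  exact: (@near_slice_size_ge xi i0 P).
exact: near_slice_size_le.
Unshelve. all: by end_near. Qed.

End asymptotics.

(** * The two dualities *)

Section duality.
Variables (R : realType) (K : fieldType) (A B C : finType) (T : tensor K A B C).
Hypotheses (T_neq0 : T <> 0) (T_tight : tight T).
Implicit Types (xi theta : 'I_3 -> R).

Local Notation Delta := (distribution_on (supp T) : set (A * B * C -> R)).

Lemma pairing_gt0 xi theta : (forall i, 0 <= xi i) -> Theta_of xi theta ->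
  0 < pairing theta xi.
Proof.
move=> xi0 [[th0 th1] thxi].
have term0 i : 0 <= theta i * xi i by rewrite mulr_ge0.
rewrite lt_neqAle sumr_ge0 ?andbT => [|i _]; last exact: term0.
apply/negP => /eqP/esym/eqP; rewrite psumr_eq0 => [|i _]; last exact: term0.
move=> /allP all0; move: th1; rewrite big1 => [/esym/eqP|i _].
  by rewrite oner_eq0.
have := all0 i (mem_index_enum _); rewrite mulf_eq0 => /orP[/eqP//|/eqP].
exact: thxi.
Qed.

(** [concave_minimax] is applied to the functions [ent Q i - xi i * g] with [xi i != 0], and the
    weights are normalized to total 1. *)
Lemma minimax_weights xi (g : R) : (forall i, 0 <= xi i) ->
  (exists i, xi i != 0) ->
  (forall Q, Delta Q -> exists2 i, xi i != 0 & ent Q i <= xi i * g) ->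
  exists2 theta, Theta_of xi theta &
    forall Q, Delta Q -> \sum_i theta i * ent Q i <= g * pairing theta xi.
Proof.
move=> xi0 [i0 xin0] Qg.
pose F i (Q : A * B * C -> R) := ent Q i - xi i * g.
pose s := [seq i <- index_enum 'I_3 | xi i != 0].
have [||||w [w0 ws wpos wle]] := @concave_minimax R _ (@mix_fun R A B C) _ F s Delta.
- exact: Delta_mix.
- move=> i t P Q t01 dP dQ; rewrite /F.
  by have := ent_concave i t01 dP dQ; lra.
- apply/negP => /eqP s0; have : i0 \in s by rewrite mem_filter xin0 mem_index_enum.
  by rewrite s0.
- move=> Q /Qg[i xin Qi]; exists i; last by rewrite /F subr_le0.
  by rewrite mem_filter xin mem_index_enum.
pose W := \sum_i w i; exists (fun i => w i / W).
  split; first split.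
  - by move=> i; rewrite divr_ge0 // ltW.
  - by rewrite -mulr_suml divff // gt_eqF.
  - by move=> i xiz; rewrite ws ?mul0r // mem_filter xiz eqxx.
move=> Q /wle h; rewrite /pairing -subr_ge0 mulr_sumr -sumrB.
have -> : \sum_i (g * (w i / W * xi i) - w i / W * ent Q i) =
    - (\sum_i w i * F i Q) / W.
  by rewrite -sumrN mulr_suml; apply: eq_bigr => i _; rewrite /F; ring.
by rewrite divr_ge0 ?oppr_ge0 // ltW.
Qed.

(** Averaging [xi i * g <= ent P i] with any admissible weights shows that [expR g] is a lower
    bound; the weights of [minimax_weights] attain it. *)
Lemma slice_support_min xi : Xi xi ->
  is_min [set support_functional theta' T `^ (pairing theta' xi)^-1
         | theta' in Theta_of xi]
    (asymptotic_slice_size xi T).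
Proof.
move=> xiX; have [xi0 _ [i1 xi1]] := (XiP xi).1 xiX.
have [P [g [dP Pg Qg ->]]] := asymptotic_slice_sizeE T_neq0 T_tight xiX.
have lower theta : Theta_of xi theta ->
    expR g <= support_functional theta T `^ (pairing theta xi)^-1.
  move=> thxi; have pos := pairing_gt0 xi0 thxi.
  have [Q dQ [-> Qmax]] := support_functionalE theta T_neq0.
  rewrite -expRM ler_expR ler_pdivlMr //; apply: le_trans (Qmax P dP).
  rewrite /pairing mulr_sumr; apply: ler_sum => i _.
  rewrite mulrCA; have [xiz|xin] := eqVneq (xi i) 0.
    by rewrite thxi.2 // !mul0r.
  by rewrite [g * _]mulrC ler_wpM2l ?Pg // thxi.1.1.
split; last by move=> _ [theta thxi <-]; exact: lower.
have [|theta thxi Qle] := minimax_weights xi0 _ Qg.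
  by exists i1; rewrite xi1 oner_neq0.
exists theta => //; apply/eqP; rewrite eq_le lower // andbT.
have [Q dQ [-> Qmax]] := support_functionalE theta T_neq0.
by rewrite -expRM ler_expR ler_pdivrMr ?pairing_gt0 // Qle.
Qed.

(* The maximum is reached at [xi i = ent P i / max_k ent P k], where [P]
   attains the support functional. *)
Lemma slice_support_max theta : Theta theta ->
  is_max [set asymptotic_slice_size xi' T `^ pairing theta xi' | xi' in @Xi R]
    (support_functional theta T).
Proof.
move=> [th0 th1]; have [P dP [-> Pmax]] := support_functionalE theta T_neq0.
have upper xi : Xi xi -> asymptotic_slice_size xi T `^ pairing theta xi <=
    expR (\sum_i theta i * ent P i).
  move=> xiX; have [Q [g [dQ Qg _ ->]]] := asymptotic_slice_sizeE T_neq0 T_tight xiX.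
  rewrite -expRM ler_expR; apply: le_trans (Pmax Q dQ).
  rewrite /pairing mulr_sumr; apply: ler_sum => i _; rewrite mulrCA ler_wpM2l //.
  have [->|xin] := eqVneq (xi i) 0; first by rewrite mulr0 (ent_ge0 i dQ).
  by rewrite mulrC Qg.
split; last by move=> _ [xi xiX <-]; exact: upper.
have [xi [h [xiX xih]]] : exists xi h, Xi xi /\ forall i, xi i * h = ent P i.
  pose k := [arg max_(i > o0) ent P i]%O.
  have kmax i : ent P i <= ent P k by rewrite /k; case: arg_maxP => // j _; exact.
  (* If all marginal entropies vanish there is nothing to normalize, and the constant 1 serves as
     [xi] with [h = 0]. *)
  have [h0|hn] := eqVneq (ent P k) 0.
    exists (fun=> 1), 0; split; first by apply/XiP; split=> //; exists o0.
    move=> i; rewrite mulr0; apply/eqP; rewrite eq_le (ent_ge0 i dP) /=.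
    by rewrite -h0 kmax.
  have hp : 0 < ent P k by rewrite lt_neqAle eq_sym hn (ent_ge0 k dP).
  exists (fun i => ent P i / ent P k), (ent P k); split; last by move=> i; rewrite divfK.
  apply/XiP; split.
  - by move=> i; rewrite divr_ge0 ?(ent_ge0 _ dP).
  - by move=> i; rewrite ler_pdivrMr // mul1r.
  - by exists k; rewrite divff.
exists xi => //; apply/eqP; rewrite eq_le upper //=.
have [Q [g [dQ _ /(_ P dP)[i xin Pi] ->]]] := asymptotic_slice_sizeE T_neq0 T_tight xiX.
have [xi0 _ _] := (XiP xi).1 xiX.
(* The max-min property at [P] gives an [i] with [xi i * h = ent P i <= xi i * g] and [xi i]
   positive. *)
have hg : h <= g.
  by move: Pi; rewrite -xih ler_pM2l // lt_neqAle eq_sym xin xi0.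
rewrite -expRM ler_expR /pairing mulr_sumr; apply: ler_sum => k _.
by rewrite mulrCA ler_wpM2l // -xih mulrC ler_wpM2r.
Qed.

End duality.

Theorem theorem5p5 (R : realType) (K : fieldType) (m1 m2 m3 : nat)
    (T : tensor K 'I_m1 'I_m2 'I_m3) (T_neq0 : T <> 0) (T_tight : tight T)
    (xi theta : 'I_3 -> R) (xi_Xi : Xi xi) (theta_Theta : Theta theta) :
  is_min [set support_functional theta' T `^ (pairing theta' xi)^-1
         | theta' in Theta_of xi]
    (asymptotic_slice_size xi T)
  /\
  is_max [set asymptotic_slice_size xi' T `^ pairing theta xi'
         | xi' in @Xi R]
    (support_functional theta T).
Proof.
by split; [exact: slice_support_min|exact: slice_support_max].
Qed.
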